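(* Let $M$ be a smooth manifold of dimension $\geq 2$, let $M_{\mathrm{sing}}\subset M$ be a closed subset with dense complement, and let $\Pi\in\mathcal{X}^2(M\setminus M_{\mathrm{sing}})$ be a Poisson bivector with a singularity at $m\in M_{\mathrm{sing}}$. The singularity is removable if and only if there is a smooth function $f\in C^\infty(U)$ on a neighborhood $U$ of $m$ such that $f e^{-\Pi}$, defined on $U\setminus M_{\mathrm{sing}}$, extends to a smooth, nowhere vanishing multivector field on all of $U$.
   Context: $\mathcal{X}^2(M)=\Gamma(M,\wedge^2TM)$ denotes bivector fields. A Poisson bivector $\Pi\in\mathcal{X}^2(M\setminus M_{\mathrm{sing}})$ has a singularity at $m\in M_{\mathrm{sing}}$ if $\Pi$ does not have a smooth extension to a neighborhood of $m$. A Dirac structure on $M$ is a smooth vector subbundle $L\subset TM\oplus T^*M$ that is maximally isotropic for $\langle X+\alpha,Y+\beta\rangle_+=\tfrac12(i_X\beta+i_Y\alpha)$ and closed under the Dorfman bracket $[X+\alpha,Y+\beta]=[X,Y]+\mathcal{L}_X\beta-i_Yd\alpha$. $\mathrm{Graph}(\Pi)=\{i_\alpha\Pi+\alpha\}$. A singularity of $\Pi$ at $m$ is removable if the closure of $\mathrm{Graph}(\Pi)$ in $TM\oplus T^*M$ is a Dirac structure over a neighborhood of $m$. The exponential is $e^{-\Pi}=1-\Pi+\tfrac12\Pi\wedge\Pi-\cdots$, an inhomogeneous multivector field (section of $\wedge^\bullet TM$); ''nowhere vanishing'' means nonzero in $\wedge^\bullet T_xM$ at every point $x$. *)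

(* Defs.v *)
From HB Require Import structures.
From mathcomp Require Import all_boot all_order all_algebra.
From mathcomp Require Import all_classical all_reals all_analysis.
Set Implicit Arguments.
Unset Strict Implicit.
Unset Printing Implicit Defensive.
Import Order.TTheory GRing.Theory Num.Theory.
Import numFieldNormedType.Exports.
Local Open Scope classical_set_scope.
Local Open Scope ring_scope.

(* C^k on an open set W: k-fold iterated directional derivatives exist (as
   directional derivatives of Frechet differentiable functions) and are
   continuous. *)
Fixpoint Ck_on (R : realType) (n k : nat) (W : set 'rV[R]_n)
    (f : 'rV[R]_n -> R) : Prop :=
  if k is k'.+1 then
    (forall z, W z -> differentiable f z) /\
    (forall v : 'rV[R]_n, Ck_on k' W (fun z => 'D_v f z))
  else forall z, W z -> {for z, continuous f}.

Definition smooth_on (R : realType) (n : nat) (W : set 'rV[R]_n)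
    (f : 'rV[R]_n -> R) : Prop :=
  forall k, Ck_on k W f.

Definition pairing (R : realType) (n : nat) (v a : 'rV[R]_n) : R :=
  \sum_i v 0 i * a 0 i.

(* Vectors and covectors are row vectors, and ('J F z) i j = d_i F_j (z). *)

Definition lie_bracket (R : realType) (n : nat)
    (X Y : 'rV[R]_n -> 'rV[R]_n) (z : 'rV[R]_n) : 'rV[R]_n :=
  'D_(X z) Y z - 'D_(Y z) X z.

(* (L_X b)_j = X^i d_i b_j + b_i d_j X^i *)
Definition lie_derivative (R : realType) (n : nat)
    (X b : 'rV[R]_n -> 'rV[R]_n) (z : 'rV[R]_n) : 'rV[R]_n :=
  'D_(X z) b z + b z *m (jacobian X z)^T.

(* (i_Y da)_j = Y^i (d_i a_j - d_j a_i) *)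
Definition contract_d (R : realType) (n : nat)
    (Y a : 'rV[R]_n -> 'rV[R]_n) (z : 'rV[R]_n) : 'rV[R]_n :=
  Y z *m (jacobian a z - (jacobian a z)^T).

(* [a S] is the coefficient of e_{i_1} /\ ... /\ e_{i_k} where
   S = {i_1 < ... < i_k}.  The pointwise ring structure that finite functions
   carry is not the one of the exterior algebra: see [wedge] and [ext_one]. *)
Definition ext (R : realType) (n : nat) := {ffun {set 'I_n} -> R^o}.

HB.instance Definition _ (R : realType) (n : nat) :=
  GRing.Lmodule.on (ext R n).

Definition ext_one (R : realType) (n : nat) : ext R n :=
  [ffun S => ((S == finset.set0)%:R : R^o)].

Definition ext_vec (R : realType) (n : nat) (v : 'rV[R]_n) : ext R n :=
  [ffun S => (\sum_(i | S == [set i]%SET) v 0 i : R^o)].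

Definition ext_tovec (R : realType) (n : nat) (a : ext R n) : 'rV[R]_n :=
  \row_i a [set i]%SET.

Definition homogeneous (R : realType) (n k : nat) (a : ext R n) : Prop :=
  forall S : {set 'I_n}, #|S| != k -> a S = 0.

(* e_A /\ e_B = (-1)^(inversions A B) e_(A U B) for disjoint A and B *)
Definition inversions (n : nat) (A B : {set 'I_n}) : nat :=
  #|[set p : 'I_n * 'I_n | [&& p.1 \in A, p.2 \in B & (p.2 < p.1)%N]]%SET|.

Definition wedge (R : realType) (n : nat) (a b : ext R n) : ext R n :=
  [ffun S : {set 'I_n} =>
    (\sum_(A : {set 'I_n} | A \subset S)
       (-1) ^+ inversions A (S :\: A)%SET * a A * b (S :\: A)%SET : R^o)].

(* i_a e_S = \sum_(i in S) (-1)^#{j in S | j < i} a_i e_(S \ i) *)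
Definition interior_product (R : realType) (n : nat) (al : 'rV[R]_n)
    (a : ext R n) : ext R n :=
  [ffun S : {set 'I_n} =>
    (\sum_(i | i \notin S)
       (-1) ^+ #|[set j in S | (j < i)%N]%SET| * al 0 i * a (i |: S)%SET
     : R^o)].

(* The k-th power of an element of positive even degree vanishes as soon as
   k > n, so that the truncation is harmless. *)
Definition ext_exp (R : realType) (n : nat) (a : ext R n) : ext R n :=
  \sum_(k < n.+1) (k`!%:R)^-1 *: iter k (wedge a) (ext_one R n).

(* The map induced on the exterior algebra by v |-> v *m A.  The iterated
   wedge runs over S in increasing order. *)
Definition ext_map (R : realType) (n : nat) (A : 'M[R]_n) (a : ext R n) :
    ext R n :=
  \sum_(S : {set 'I_n})
    a S *: \big[@wedge R n/ext_one R n]_(i in S) ext_vec (row i A).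

Record chart (R : realType) (n : nat) (T : topologicalType) := Chart {
  chart_dom : set T;
  chart_map :> T -> 'rV[R]_n;
  chart_inv : 'rV[R]_n -> T;
  chart_dom_open : open chart_dom;
  chart_image_open : open (chart_map @` chart_dom);
  chart_mapK : {in chart_dom, cancel chart_map chart_inv};
  chart_continuous : {within chart_dom, continuous chart_map};
  chart_inv_continuous :
    {within chart_map @` chart_dom, continuous chart_inv}
}.

(* [chart_at x] is a chart around x, chosen once and for all: it is used to
   identify the tangent space at x with R^n. *)
Record smoothManifold (R : realType) (n : nat) := SmoothManifold {
  manifold_sort :> topologicalType;
  manifold_hausdorff : hausdorff_space manifold_sort;
  manifold_second_countable : @second_countable manifold_sort;
  atlas : set (chart R n manifold_sort);
  atlas_compatible : forall c d, atlas c -> atlas d -> forall j,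
    smooth_on (c @` (chart_dom c `&` chart_dom d))
      (fun z => d (chart_inv c z) 0 j);
  chart_at : manifold_sort -> chart R n manifold_sort;
  chart_at_atlas : forall x, atlas (chart_at x);
  chart_at_dom : forall x, chart_dom (chart_at x) x
}.

(* A tangent vector at x is represented by its row of coordinates in
   [chart_at x].  Multiplication by [to_chart c x] turns it into its row of
   coordinates in the chart c. *)
Definition to_chart (R : realType) (n : nat) (M : smoothManifold R n)
    (c : chart R n M) (x : M) : 'M[R]_n :=
  jacobian (c \o chart_inv (chart_at x)) (chart_at x x).

Definition of_chart (R : realType) (n : nat) (M : smoothManifold R n)
    (c : chart R n M) (x : M) : 'M[R]_n :=
  jacobian (chart_at x \o chart_inv c) (c x).

(* Covectors transform contragrediently to vectors. *)
Definition gcoord (R : realType) (n : nat) (M : smoothManifold R n)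
    (c : chart R n M) (x : M) (u : 'rV[R]_n * 'rV[R]_n) :
    'rV[R]_n * 'rV[R]_n :=
  (u.1 *m to_chart c x, u.2 *m (of_chart c x)^T).

Definition smooth_fun (R : realType) (n : nat) (M : smoothManifold R n)
    (V : set M) (f : M -> R) : Prop :=
  forall c, atlas c -> smooth_on (c @` (chart_dom c `&` V)) (f \o chart_inv c).

(* Values of fields outside V are irrelevant here and below. *)
Definition smooth_multivector (R : realType) (n : nat)
    (M : smoothManifold R n) (V : set M) (s : M -> ext R n) : Prop :=
  forall c, atlas c -> forall S,
    smooth_on (c @` (chart_dom c `&` V))
      (fun z => let x := chart_inv c z in ext_map (to_chart c x) (s x) S).

Definition smooth_bivector (R : realType) (n : nat)
    (M : smoothManifold R n) (V : set M) (P : M -> ext R n) : Prop :=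
  (forall x, V x -> homogeneous 2 (P x)) /\ smooth_multivector V P.

Definition sharp (R : realType) (n : nat) (P : ext R n) (al : 'rV[R]_n) :
    'rV[R]_n :=
  ext_tovec (interior_product al P).

Definition differential (R : realType) (n : nat) (M : smoothManifold R n)
    (f : M -> R) (x : M) : 'rV[R]_n :=
  \row_i 'D_(delta_mx 0 i) (f \o chart_inv (chart_at x)) (chart_at x x).

(* {f, g} = P(df, dg) *)
Definition poisson_bracket (R : realType) (n : nat)
    (M : smoothManifold R n) (P : M -> ext R n) (f g : M -> R) (x : M) : R :=
  pairing (sharp (P x) (differential f x)) (differential g x).

(* The Jacobi identity is required for locally defined functions. *)
Definition poisson_bivector (R : realType) (n : nat)
    (M : smoothManifold R n) (U : set M) (P : M -> ext R n) : Prop :=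
  smooth_bivector U P /\
  forall (V : set M) (f g h : M -> R), open V -> V `<=` U ->
    smooth_fun V f -> smooth_fun V g -> smooth_fun V h ->
    forall x, V x ->
      poisson_bracket P f (poisson_bracket P g h) x +
      poisson_bracket P g (poisson_bracket P h f) x +
      poisson_bracket P h (poisson_bracket P f g) x = 0.

(* The total space of TM (+) T*M: a point is (x, (X, al)). *)
Definition gtangent (R : realType) (n : nat) (M : smoothManifold R n) : Type :=
  (M * ('rV[R]_n * 'rV[R]_n))%type.

HB.instance Definition _ (R : realType) (n : nat) (M : smoothManifold R n) :=
  Choice.on (gtangent M).

Definition gtangent_chart (R : realType) (n : nat) (M : smoothManifold R n)
    (c : chart R n M) (p : gtangent M) :
    ('rV[R]_n * ('rV[R]_n * 'rV[R]_n))%type :=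
  (c p.1, gcoord c p.1 p.2).

(* The manifold topology of the total space (not the product topology of
   M * R^2n): the maps [gtangent_chart c], restricted to the points over
   [chart_dom c], are homeomorphisms onto open sets. *)
Section GTangentTopology.
Context (R : realType) (n : nat) (M : smoothManifold R n).

Definition gtangent_open (W : set (gtangent M)) : Prop :=
  forall p, W p -> forall c, atlas c -> chart_dom c p.1 ->
    exists2 N, nbhs (gtangent_chart c p) N &
      forall q : gtangent M, chart_dom c q.1 -> N (gtangent_chart c q) -> W q.

Lemma gtangent_openT : gtangent_open setT.
Proof. by move=> p _ c _ _; exists setT => //; exact: filterT. Qed.

Lemma gtangent_openI (A B : set (gtangent M)) :
  gtangent_open A -> gtangent_open B -> gtangent_open (A `&` B).
Proof.
move=> oA oB p [Ap Bp] c ac cp.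
have [N nN NA] := oA p Ap c ac cp; have [N' nN' NB] := oB p Bp c ac cp.
exists (N `&` N'); first exact: filterI.
by move=> q cq [Nq N'q]; split; [exact: NA|exact: NB].
Qed.

Lemma gtangent_open_bigU (I : Type) (F : I -> set (gtangent M)) :
  (forall i, gtangent_open (F i)) -> gtangent_open (\bigcup_i F i).
Proof.
move=> oF p [i _ Fp] c ac cp; have [N nN NF] := oF i p Fp c ac cp.
by exists N => // q cq Nq; exists i => //; exact: NF.
Qed.

HB.instance Definition _ := isOpenTopological.Build (gtangent M)
  gtangent_openT gtangent_openI gtangent_open_bigU.

End GTangentTopology.

Definition dirac_pairing (R : realType) (n : nat)
    (u v : 'rV[R]_n * 'rV[R]_n) : R :=
  2^-1 * (pairing u.1 v.2 + pairing v.1 u.2).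

Definition maximally_isotropic (R : realType) (n : nat)
    (A : set ('rV[R]_n * 'rV[R]_n)) : Prop :=
  (forall u v, A u -> A v -> dirac_pairing u v = 0) /\
  (forall W : {vspace ('rV[R]_n * 'rV[R]_n)%type},
     (forall u v, u \in W -> v \in W -> dirac_pairing u v = 0) ->
     (forall u, A u -> u \in W) -> forall u, u \in W -> A u).

Definition smooth_gsection (R : realType) (n : nat)
    (M : smoothManifold R n) (V : set M) (s : M -> 'rV[R]_n * 'rV[R]_n) :
    Prop :=
  forall c, atlas c -> forall i,
    smooth_on (c @` (chart_dom c `&` V))
      (fun z => let x := chart_inv c z in (gcoord c x (s x)).1 0 i) /\
    smooth_on (c @` (chart_dom c `&` V))
      (fun z => let x := chart_inv c z in (gcoord c x (s x)).2 0 i).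

(* [X + a, Y + b] = [X, Y] + L_X b - i_Y da at x, computed in the coordinates
   of [chart_at x] *)
Definition dorfman (R : realType) (n : nat) (M : smoothManifold R n)
    (s t : M -> 'rV[R]_n * 'rV[R]_n) (x : M) : 'rV[R]_n * 'rV[R]_n :=
  let c := chart_at x in
  let loc u z := gcoord c (chart_inv c z) (u (chart_inv c z)) in
  let X z := (loc s z).1 in let a z := (loc s z).2 in
  let Y z := (loc t z).1 in let b z := (loc t z).2 in
  (lie_bracket X Y (c x), lie_derivative X b (c x) - contract_d Y a (c x)).

Definition smooth_subbundle (R : realType) (n : nat)
    (M : smoothManifold R n) (U : set M) (L : set (gtangent M)) : Prop :=
  forall x, U x -> exists (V : set M) (k : nat)
    (s : 'I_k -> M -> 'rV[R]_n * 'rV[R]_n),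
    [/\ open V, V x, V `<=` U, forall i, smooth_gsection V (s i) &
      forall y, V y ->
        let e := [seq s i y | i <- enum 'I_k] in
        free e /\ forall u, L (y, u) <-> u \in <<e>>%VS].

(* Involutivity is required for the sections of L over all open subsets. *)
Definition dorfman_closed (R : realType) (n : nat)
    (M : smoothManifold R n) (U : set M) (L : set (gtangent M)) : Prop :=
  forall (V : set M) (s t : M -> 'rV[R]_n * 'rV[R]_n),
    open V -> V `<=` U -> smooth_gsection V s -> smooth_gsection V t ->
    (forall y, V y -> L (y, s y)) -> (forall y, V y -> L (y, t y)) ->
    forall y, V y -> L (y, dorfman s t y).

(* Only the part of L lying over U matters. *)
Definition dirac_over (R : realType) (n : nat) (M : smoothManifold R n)
    (U : set M) (L : set (gtangent M)) : Prop :=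
  [/\ smooth_subbundle U L,
      forall x, U x -> maximally_isotropic [set u | L (x, u)] &
      dorfman_closed U L].

Definition graph_of (R : realType) (n : nat) (M : smoothManifold R n)
    (Msing : set M) (P : M -> ext R n) : set (gtangent M) :=
  [set p | ~ Msing p.1 /\ p.2.1 = sharp (P p.1) p.2.2].

Definition has_singularity (R : realType) (n : nat)
    (M : smoothManifold R n) (Msing : set M) (P : M -> ext R n) (m : M) :
    Prop :=
  ~ exists (U : set M) (Q : M -> ext R n),
      [/\ open U, U m, smooth_bivector U Q &
          forall x, U x -> ~ Msing x -> Q x = P x].

Definition removable (R : realType) (n : nat)
    (M : smoothManifold R n) (Msing : set M) (P : M -> ext R n) (m : M) :
    Prop :=
  exists U : set M,
    [/\ open U, U m & dirac_over U (closure (graph_of Msing P))].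

(* Main.v *)
Require Import Defs.
From HB Require Import structures.
From mathcomp Require Import all_boot all_order all_algebra.
From mathcomp Require Import all_classical all_reals all_analysis.
From mathcomp Require Import ring zify.
Set Implicit Arguments.
Unset Strict Implicit.
Unset Printing Implicit Defensive.
Import Order.TTheory GRing.Theory Num.Theory.
Import numFieldNormedType.Exports.
Local Open Scope classical_set_scope.
Local Open Scope ring_scope.

(* A multivector a is annihilated by X + al when X /\ a + i_al a = 0, and the
   annihilator of exp(-Pi) is exactly the graph of Pi.  If the closure L of the
   graph is a Dirac structure, with local frame s_1, ..., s_k, then letting
   s_1, ..., s_k act in turn on a suitable constant multivector produces a
   smooth nonvanishing sigma annihilated by L; over the regular points sigma is
   therefore a multiple of exp(-Pi), the factor f being its component of
   degree 0.  Conversely, given sigma = f exp(-Pi), the annihilator of sigma is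
   isotropic everywhere and of rank n on a dense set.  Hence it has rank n
   everywhere and is the closure of the graph.  It is involutive at the regular
   points by the Jacobi identity, and everywhere by continuity. *)

(** * The Clifford action on multivectors *)

(** Why the rank stays n: by the Clifford relation the annihilator of a nonzero multivector is
    isotropic, hence of dimension at most n in a space of dimension 2n. The matrix of u |-> u .
    sigma therefore has rank at least n everywhere. On the dense regular set its rank is exactly n,
    and having rank at most n is a closed condition. Near a singular point a smooth frame of the
    kernel comes from an invertible minor by Cramer's rule with denominators cleared, so its entries
    are polynomial in the coordinates of sigma. The obstacle is that vectors at x are recorded in
    [chart_at x], which may jump with x: the raw values of a field, or of [dorfman], carry no
    continuity. Every limit argument is moved to one fixed chart by [to_chartL] and [of_chartL].
    Between two charts these change by smooth Jacobians, and the Clifford action is equivariant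
    under the move. In the forward direction the constant multivector must survive the product s_1
    ... s_k at m; it exists because the frame is free and the pairing is nondegenerate. *)

Section Exterior.
Context {R : realType} {n : nat}.
Implicit Types (S T : {set 'I_n}) (a b : ext R n) (v w al be : 'rV[R]_n)
  (u : 'rV[R]_n * 'rV[R]_n).

Definition ext_sign (i : 'I_n) S : R :=
  (-1) ^+ #|[set j in S | (j < i)%N]%SET|.

(** Symmetric difference with {i}. Wedging with e_i and contracting with its dual both relate the
    coefficients at S and at [toggle i S], with the same sign [ext_sign i S], so one sum over i
    describes both halves of [clifford]. *)
Definition toggle (i : 'I_n) S : {set 'I_n} :=
  if i \in S then (S :\ i)%SET else (i |: S)%SET.

(** The spinor representation of the Clifford algebra of V + V*: vectors wedge, covectors
    contract. *)
Definition clifford u a : ext R n :=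
  wedge (ext_vec u.1) a + interior_product u.2 a.

Lemma ext_sign_sqr i S : ext_sign i S * ext_sign i S = 1.
Proof. by rewrite /ext_sign -expr2 sqrr_sign. Qed.

Lemma in_toggle i j S : (i \in toggle j S) = (i == j) (+) (i \in S).
Proof.
rewrite /toggle; case: ifPn => jS; rewrite !inE; case: eqVneq => //= ->.
  by rewrite jS.
by rewrite (negbTE jS).
Qed.

Lemma toggleK i : involutive (toggle i).
Proof.
by move=> S; apply/finset.setP => j; rewrite !in_toggle addbA addbb.
Qed.

Lemma toggleC i j S : toggle i (toggle j S) = toggle j (toggle i S).
Proof. by apply/finset.setP => k; rewrite !in_toggle addbCA. Qed.

Lemma ext_sign_toggle i j S :
  ext_sign i (toggle j S) = (-1) ^+ (j < i)%N * ext_sign i S.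
Proof.
have E : [set k in toggle j S | (k < i)%N]%SET =
    if (j < i)%N then toggle j [set k in S | (k < i)%N]%SET
    else [set k in S | (k < i)%N]%SET.
  apply/finset.setP => k; rewrite inE in_toggle.
  by case: ifPn => ji; rewrite ?in_toggle !inE;
    case: (eqVneq k j) => [->|] //=; rewrite ?ji ?(negbTE ji) ?andbT ?andbF.
rewrite /ext_sign E; case: ifPn => //= ji; last by rewrite mul1r.
rewrite /toggle; case: ifPn => jA.
  rewrite [in RHS](cardsD1 j) jA.
  by rewrite exprD mulrA -expr2 sqrr_sign mul1r.
by rewrite cardsU1 jA exprD.
Qed.

Lemma inversions1 i S : inversions [set i]%SET S = #|[set j in S | (j < i)%N]%SET|.
Proof.
rewrite /inversions.
have -> : [set p : 'I_n * 'I_n |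
    [&& p.1 \in [set i]%SET, p.2 \in S & (p.2 < p.1)%N]]%SET =
    finset.imset (fun j => (i, j)) (mem [set j in S | (j < i)%N]%SET).
  apply/finset.setP => -[k j]; rewrite !inE /=; apply/idP/imsetP.
    move=> /and3P[/eqP -> jS ji]; exists j => //.
    by rewrite inE jS.
  by move=> [l]; rewrite inE => /andP[lS li] [-> ->]; rewrite eqxx lS.
by rewrite card_imset // => j k [].
Qed.

Lemma wedge_vecE v a S : wedge (ext_vec v) a S =
  \sum_(i in S) ext_sign i S * v 0 i * a (toggle i S).
Proof.
rewrite ffunE.
under eq_bigr do rewrite ffunE mulr_sumr mulr_suml.
rewrite (exchange_big_dep predT) //= [RHS]big_mkcond /=.
apply: eq_bigr => i _; case: ifPn => iS.
  rewrite (big_pred1 [set i]%SET) => [|A]; last first.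
    by rewrite /=; case: eqVneq => [->|_]; rewrite ?andbF ?finset.sub1set ?iS.
  rewrite inversions1 /toggle iS; congr (_ * _ * _).
  rewrite /ext_sign; congr (_ ^+ _); apply: eq_card => j; rewrite !inE.
  by case: (eqVneq j i) => [->|_] //=; rewrite ltnn andbF.
rewrite big_pred0 // => A; apply/negP => /andP[AS /eqP AE].
by move: AS; rewrite AE finset.sub1set (negbTE iS).
Qed.

Lemma interiorE al a S : interior_product al a S =
  \sum_(i | i \notin S) ext_sign i S * al 0 i * a (toggle i S).
Proof.
by rewrite ffunE; apply: eq_bigr => i iS; rewrite /toggle (negbTE iS).
Qed.

Lemma extD a b S : (a + b) S = a S + b S. Proof. by rewrite ffunE. Qed.
Lemma extN a S : (- a) S = - a S. Proof. by rewrite ffunE. Qed.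
Lemma ext0 S : (0 : ext R n) S = 0. Proof. by rewrite ffunE. Qed.
Lemma extZ (k : R) a S : (k *: a) S = k * a S. Proof. by rewrite ffunE. Qed.
Lemma ext_sum I (r : seq I) (Q : pred I) (F : I -> ext R n) S :
  (\sum_(i <- r | Q i) F i) S = \sum_(i <- r | Q i) F i S.
Proof.
by elim/big_rec2: _ => [|i x y _ <-]; rewrite ?ext0 ?extD.
Qed.

Lemma cliffordE u a S : clifford u a S =
  \sum_i ext_sign i S * (if i \in S then u.1 0 i else u.2 0 i) *
         a (toggle i S).
Proof.
rewrite extD wedge_vecE interiorE big_mkcond /= [X in _ + X]big_mkcond /=.
rewrite -big_split /=; apply: eq_bigr => i _.
by case: ifPn => iS; rewrite ?addr0 ?add0r.
Qed.

(** The Clifford relation; the scalar is twice [dirac_pairing u1 u2]. Sign rules for wedges and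
    contractions of vectors, isotropy of annihilators and the vanishing of squares all follow from
    it. *)
Lemma clifford_anticomm u1 u2 a :
  clifford u1 (clifford u2 a) + clifford u2 (clifford u1 a) =
  (pairing u1.1 u2.2 + pairing u2.1 u1.2) *: a.
Proof.
apply/ffunP => S; rewrite extD extZ !cliffordE /=.
pose co u i S := if i \in S then u.1 0 i else u.2 0 i : R.
pose F u u' i j : R := ext_sign i S * co u i S *
   (ext_sign j (toggle i S) * co u' j (toggle i S) *
     a (toggle j (toggle i S))).
(* The second double sum is transposed, so that both terms toggle the same two indices. For i
   different from j exactly one of the two orders produces an extra sign, and the terms cancel; only
   the diagonal survives. *)
transitivity (\sum_i \sum_j (F u1 u2 i j + F u2 u1 j i)).
  under [RHS]eq_bigr do rewrite big_split /=.
  rewrite big_split /= [X in _ = _ + X]exchange_big /=.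
  by congr (_ + _); apply: eq_bigr => i _; rewrite cliffordE mulr_sumr.
rewrite /pairing -big_split mulr_suml /=; apply: eq_bigr => i _.
rewrite (bigD1 i) //= big1 ?addr0 => [|j ji].
  rewrite /F /co !in_toggle eqxx toggleK !ext_sign_toggle ltnn !mul1r.
  have := ext_sign_sqr i S; set e := ext_sign i S => ee.
  case: ifPn => iS /=.
    transitivity ((e * e) * ((u1.1 0 i * u2.2 0 i + u2.1 0 i * u1.2 0 i) * a S)).
      by ring.
    by rewrite ee mul1r.
  transitivity ((e * e) * ((u1.1 0 i * u2.2 0 i + u2.1 0 i * u1.2 0 i) * a S)).
    by ring.
  by rewrite ee mul1r.
rewrite /F /co !in_toggle (negbTE ji) [i == j]eq_sym (negbTE ji) /= toggleC.
rewrite !ext_sign_toggle.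
case: (ltngtP i j) ji => [||/val_inj ->]; rewrite ?eqxx /= ?expr0 ?expr1 // => _ _;
  set x := (if _ then _ else _); set y := (if _ then _ else _); ring.
Qed.

Lemma wedge_linear_r (a : ext R n) : linear (wedge a).
Proof.
move=> k b c; apply/ffunP => S; rewrite extD extZ !ffunE.
rewrite mulr_sumr -big_split /=; apply: eq_bigr => A _.
by rewrite extD extZ; ring.
Qed.

Lemma wedge_linear_l (b : ext R n) : linear (fun a => wedge a b).
Proof.
move=> k a c; apply/ffunP => S; rewrite extD extZ !ffunE.
rewrite mulr_sumr -big_split /=; apply: eq_bigr => A _.
by rewrite extD extZ; ring.
Qed.

Lemma interior_linear al : linear (@interior_product R n al).
Proof.
move=> k a b; apply/ffunP => S; rewrite extD extZ !ffunE.
rewrite mulr_sumr -big_split /=; apply: eq_bigr => i _.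
by rewrite extD extZ; ring.
Qed.

Lemma clifford_linear u : linear (clifford u).
Proof.
move=> k a b; rewrite /clifford wedge_linear_r interior_linear scalerDr.
by rewrite addrACA.
Qed.

HB.instance Definition _ (a : ext R n) :=
  GRing.isLinear.Build R (ext R n) (ext R n) _ (wedge a) (wedge_linear_r a).
HB.instance Definition _ al :=
  GRing.isLinear.Build R (ext R n) (ext R n) _ (interior_product al)
    (interior_linear al).
HB.instance Definition _ u :=
  GRing.isLinear.Build R (ext R n) (ext R n) _ (clifford u) (clifford_linear u).

Lemma wedge0l a : wedge 0 a = 0.
Proof.
by have := wedge_linear_l a (-1) 0 0; rewrite !scaler0 addr0 scaleN1r addNr.
Qed.

Lemma wedgeDl a b (d : ext R n) : wedge (a + b) d = wedge a d + wedge b d.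
Proof. by have := wedge_linear_l d 1 a b; rewrite !scale1r. Qed.

Lemma wedgeZl (k : R) a (d : ext R n) : wedge (k *: a) d = k *: wedge a d.
Proof. by have := wedge_linear_l d k a 0; rewrite wedge0l !addr0. Qed.

Lemma clifford_linear_l a : linear (fun u => clifford u a).
Proof.
move=> k u1 u2; apply/ffunP => S; rewrite [LHS]cliffordE extD extZ !cliffordE.
rewrite mulr_sumr.
rewrite -big_split /=; apply: eq_bigr => i _.
by case: ifP => _; rewrite !mxE; ring.
Qed.

Lemma clifford0l a : clifford 0 a = 0.
Proof.
by have := clifford_linear_l a (-1) 0 0; rewrite !scaler0 addr0 scaleN1r addNr.
Qed.

Lemma cliffordDl u1 u2 a : clifford (u1 + u2) a = clifford u1 a + clifford u2 a.
Proof. by have := clifford_linear_l a 1 u1 u2; rewrite !scale1r. Qed.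

Lemma cliffordZl (k : R) u a : clifford (k *: u) a = k *: clifford u a.
Proof. by have := clifford_linear_l a k u 0; rewrite clifford0l !addr0. Qed.

Lemma clifford_suml I (r : seq I) (F : I -> 'rV[R]_n * 'rV[R]_n) a :
  clifford (\sum_(i <- r) F i) a = \sum_(i <- r) clifford (F i) a.
Proof.
by elim/big_rec2: _ => [|i x y _ <-]; rewrite ?clifford0l ?cliffordDl.
Qed.

Lemma interior0l a : interior_product 0 a = 0.
Proof.
apply/ffunP => S; rewrite ext0 interiorE big1 // => i _.
by rewrite mxE mulr0 mul0r.
Qed.

Lemma ext_vec0 : ext_vec 0 = 0 :> ext R n.
Proof. by apply/ffunP => S; rewrite !ffunE big1 // => i _; rewrite mxE. Qed.

Lemma clifford_vec v a : clifford (v, 0) a = wedge (ext_vec v) a.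
Proof. by rewrite /clifford interior0l addr0. Qed.

Lemma clifford_covec al a : clifford (0, al) a = interior_product al a.
Proof. by rewrite /clifford /= ext_vec0 wedge0l add0r. Qed.

Lemma pairing0l al : pairing 0 al = 0 :> R.
Proof. by rewrite /pairing big1 // => i _; rewrite mxE mul0r. Qed.

Lemma pairing0r v : pairing v 0 = 0 :> R.
Proof. by rewrite /pairing big1 // => i _; rewrite mxE mulr0. Qed.

Lemma pairing_delta (i : 'I_n) al : pairing (delta_mx 0 i) al = al 0 i.
Proof.
rewrite /pairing (bigD1 i) //= big1 ?addr0 => [|j ji].
  by rewrite mxE !eqxx mul1r.
by rewrite mxE (negbTE ji) andbF mul0r.
Qed.

Lemma pairing_deltar (i : 'I_n) v : pairing v (delta_mx 0 i) = v 0 i.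
Proof.
rewrite -[RHS]pairing_delta /pairing; apply: eq_bigr => j _; exact: mulrC.
Qed.

Lemma wedge_vecC v w a :
  wedge (ext_vec v) (wedge (ext_vec w) a) =
  - wedge (ext_vec w) (wedge (ext_vec v) a).
Proof.
apply/eqP; rewrite -addr_eq0 -!clifford_vec clifford_anticomm /=.
by rewrite !pairing0r addr0 scale0r.
Qed.

Lemma wedge_vec_sqr v a : wedge (ext_vec v) (wedge (ext_vec v) a) = 0.
Proof.
have /eqP := wedge_vecC v v a; rewrite -addr_eq0 -mulr2n -scaler_nat.
by rewrite scaler_eq0 pnatr_eq0 /= => /eqP.
Qed.

Lemma interior_wedge_vec v al a :
  interior_product al (wedge (ext_vec v) a) =
  pairing v al *: a - wedge (ext_vec v) (interior_product al a).
Proof.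
apply/eqP; rewrite eq_sym subr_eq eq_sym -!clifford_vec -!clifford_covec.
by rewrite clifford_anticomm /= pairing0l add0r.
Qed.

Definition ext_basis (T : {set 'I_n}) : ext R n := [ffun S => ((S == T)%:R : R^o)].

Lemma ext_basisE S T : ext_basis T S = (S == T)%:R :> R.
Proof. by rewrite ffunE. Qed.

Lemma ext_decomp a : a = \sum_S a S *: ext_basis S.
Proof.
apply/ffunP => S; rewrite ext_sum (bigD1 S) //= big1 => [|T TS].
  by rewrite extZ ext_basisE eqxx mulr1 addr0.
by rewrite extZ ext_basisE eq_sym (negbTE TS) mulr0.
Qed.

Lemma wedge_deltaE i a S : wedge (ext_vec (delta_mx 0 i)) a S =
  if i \in S then ext_sign i S * a (toggle i S) else 0.
Proof.
rewrite wedge_vecE big_mkcond (bigD1 i) //= big1 => [|j ji]; last first.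
  by rewrite mxE (negbTE ji) andbF mulr0 mul0r if_same.
by rewrite mxE !eqxx mulr1 addr0.
Qed.

Lemma toggle_eq i S T : (toggle i S == T) = (S == toggle i T).
Proof. by rewrite -(inj_eq (inv_inj (toggleK i))) toggleK. Qed.

Lemma wedge_delta_basis i T : i \notin T ->
  wedge (ext_vec (delta_mx 0 i)) (ext_basis T) =
  ext_sign i T *: ext_basis (i |: T).
Proof.
move=> iT; apply/ffunP => S; rewrite wedge_deltaE extZ !ext_basisE toggle_eq.
rewrite /toggle (negbTE iT).
case: ifPn => iS; case: eqVneq => [E|_]; rewrite ?mulr0 //.
  have -> : S = toggle i T by rewrite /toggle (negbTE iT).
  by rewrite ext_sign_toggle ltnn mul1r.
by move: iS; rewrite E !inE eqxx.
Qed.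

(** The exterior algebra is generated from 1 by wedging with basis vectors: an element i is split
    off [T], and [ext_sign_sqr] removes the resulting sign. *)
Lemma ext_ind (K : ext R n -> Prop) :
  K (ext_one R n) -> (forall k a b, K a -> K b -> K (k *: a + b)) ->
  (forall i a, K a -> K (wedge (ext_vec (delta_mx 0 i)) a)) -> forall a, K a.
Proof.
move=> K1 KD KE.
have K0 : K 0 by rewrite -(addNr (ext_one R n)) -scaleN1r; exact: KD.
have KZ k b : K b -> K (k *: b) by move=> Kb; rewrite -[_ *: _]addr0; exact: KD.
have KB T : K (ext_basis T).
  have [m] := ubnP #|T|; elim: m => // m IH in T *; rewrite ltnS => Tm.
  have [->|[i iT]] := set_0Vmem T.
    exact: K1.
  rewrite -(finset.setD1K iT); have iT' : i \notin (T :\ i)%SET by rewrite !inE eqxx.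
  rewrite -[ext_basis _]scale1r -(ext_sign_sqr i (T :\ i)%SET) -scalerA.
  rewrite -wedge_delta_basis //; apply: KZ; apply: KE; apply: IH.
  by move: Tm; rewrite (cardsD1 i) iT.
move=> a; rewrite (ext_decomp a).
by elim/big_rec: _ => // S b _ Kb; exact: KD.
Qed.

Lemma wedge_vec1 v : wedge (ext_vec v) (ext_one R n) = ext_vec v.
Proof.
apply/ffunP => S; rewrite wedge_vecE [RHS]ffunE big_mkcond [RHS]big_mkcond /=.
apply: eq_bigr => i _; case: ifPn => iS; last first.
  by case: eqVneq => // E; move: iS; rewrite E inE eqxx.
have -> : ext_one R n (toggle i S) = (S == [set i]%SET)%:R.
  rewrite ffunE toggle_eq; congr (_ == _)%:R.
  by rewrite /toggle inE finset.setU0.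
case: eqVneq => [->|_]; rewrite ?mulr0 // mulr1 /ext_sign.
rewrite (_ : [set j in _ | _]%SET = finset.set0) ?cards0 ?mul1r //.
by apply/finset.setP => j; rewrite !inE; case: eqVneq => [->|//]; rewrite ltnn.
Qed.

Lemma interior_one al : interior_product al (ext_one R n) = 0.
Proof.
apply/ffunP => S; rewrite interiorE ext0 big1 // => i iS.
rewrite ffunE toggle_eq /toggle inE finset.setU0.
by case: eqVneq => [E|_]; rewrite ?mulr0 //; move: iS; rewrite E inE eqxx.
Qed.

End Exterior.

(** * The exponential of a bivector as a spinor *)

Section Bivector.
Context {R : realType} {n : nat}.
Implicit Types (S T : {set 'I_n}) (a b P : ext R n) (v w al be : 'rV[R]_n)
  (u : 'rV[R]_n * 'rV[R]_n).

Lemma inversionsE S T :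
  inversions S T = \sum_(i in S) #|[set j in T | (j < i)%N]%SET|.
Proof.
rewrite /inversions -sum1_card.
rewrite (eq_bigl (fun p : 'I_n * 'I_n =>
    (p.1 \in S) && (p.2 \in [set j in T | (j < p.1)%N]%SET))).
  rewrite -(pair_big_dep (mem S)
    (fun i j => j \in [set j in T | (j < i)%N]%SET) (fun _ _ => 1%N)) /=.
  by apply: eq_bigr => i _; rewrite sum1_card.
by move=> [i j]; rewrite !inE.
Qed.

(** Takes the place of general associativity: together with [bivector_ind] it turns wedging with a
    bivector into two wedges with vectors. *)
Lemma wedge_basis2 (i j : 'I_n) a : (i < j)%N ->
  wedge (ext_basis [set i; j]%SET) a =
  wedge (ext_vec (delta_mx 0 i)) (wedge (ext_vec (delta_mx 0 j)) a).
Proof.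
move=> ij; have nij : i != j by rewrite -val_eqE neq_ltn ij.
apply/ffunP => S; rewrite !wedge_deltaE in_toggle [j == i]eq_sym (negbTE nij) /=.
rewrite [LHS]ffunE big_mkcond (bigD1 [set i; j]%SET) //= big1 => [|T TS]; last first.
  by rewrite ext_basisE (negbTE TS) mulr0 mul0r if_same.
rewrite addr0 ext_basisE eqxx mulr1 finset.subUset !finset.sub1set.
case: ifPn => [/andP[iS jS]|]; last by case: (i \in S); case: (j \in S); rewrite //= mulr0.
rewrite iS jS mulrA; congr (_ * _).
  rewrite inversionsE big_setU1 ?inE //= big_set1 exprD /ext_sign.
  congr (_ ^+ _ * _ ^+ _); apply: eq_card => k; rewrite !inE.
    case: (eqVneq k i) => [->|_] /=; first by rewrite ltnn andbF.
    by case: (eqVneq k j) => [->|_] //=; rewrite ltnNge (ltnW ij) andbF.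
  rewrite /toggle iS !inE; case: (eqVneq k j) => [->|_] /=.
    by rewrite ltnn !andbF.
  by rewrite orbF.
congr (a _); rewrite /toggle iS !inE eq_sym nij jS /=.
by apply/finset.setP => k; rewrite !inE negb_or andbA [(_ != j) && _]andbC.
Qed.

Lemma interior_homogeneous2 P al : homogeneous 2 P ->
  interior_product al P = ext_vec (sharp P al).
Proof.
move=> hP; apply/ffunP => S; rewrite [RHS]ffunE.
have [/cards1P[i ->]|S1] := boolP (#|S| == 1)%N.
  rewrite (bigD1 i) ?eqxx //= big1 => [|j]; first by rewrite addr0 mxE.
  by case/andP => /eqP/finset.set1_inj ->; rewrite eqxx.
rewrite [RHS]big1 => [|i /eqP E]; last by move: S1; rewrite E cards1.
rewrite interiorE big1 // => i iS; rewrite hP ?mulr0 //.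
by rewrite /toggle (negbTE iS) cardsU1 iS.
Qed.

Lemma bivector_ind (K : ext R n -> Prop) : K 0 ->
  (forall k P Q, K P -> K Q -> K (k *: P + Q)) ->
  (forall i j : 'I_n, (i < j)%N -> K (ext_basis [set i; j]%SET)) ->
  forall P, homogeneous 2 P -> K P.
Proof.
move=> K0 KD KB P hP; rewrite (ext_decomp P); elim/big_rec: _ => // S b _ Kb.
have [/cards2P[i [j [nij ->]]]|S2] := boolP (#|S| == 2)%N; last first.
  by rewrite hP // scale0r add0r.
apply: KD => //; move: nij; rewrite -val_eqE neq_ltn => /orP[|ji]; first exact: KB.
by rewrite finset.setUC; exact: KB.
Qed.

(** A vector passes two vector factors, and the two signs cancel. *)
Lemma wedge_bivector_vec P v a : homogeneous 2 P ->
  wedge P (wedge (ext_vec v) a) = wedge (ext_vec v) (wedge P a).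
Proof.
move: P; apply: bivector_ind => [|k P Q hP hQ|i j ij].
- by rewrite !wedge0l raddf0.
- by rewrite !wedgeDl !wedgeZl hP hQ linearD linearZ.
- rewrite !wedge_basis2 // [wedge (ext_vec v) (wedge _ _)]wedge_vecC.
  by rewrite [in RHS](wedge_vecC v) raddfN opprK.
Qed.

(** Contraction is an antiderivation; past a factor of even degree its sign disappears. *)
Lemma interior_bivector P al a : homogeneous 2 P ->
  interior_product al (wedge P a) =
  wedge (interior_product al P) a + wedge P (interior_product al a).
Proof.
move: P; apply: bivector_ind => [|k P Q hP hQ|i j ij].
- by rewrite !wedge0l !raddf0 wedge0l addr0.
- rewrite !(wedgeDl, wedgeZl, linearD, linearZ) /= hP hQ.
  by rewrite scalerDr addrACA.
- have PE : ext_basis [set i; j]%SET = wedge (ext_vec (delta_mx 0 i))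
      (wedge (ext_vec (delta_mx 0 j)) (ext_one R n)).
    rewrite -wedge_basis2 //; apply/ffunP => S; rewrite [RHS]ffunE.
    rewrite big_mkcond (bigD1 S) //= big1 => [|T TS].
      by rewrite subxx addr0 finset.setDv inversionsE big1 => [|k _];
        rewrite ?ffunE ?eqxx ?mulr1 ?mul1r // eq_card0 // => l; rewrite !inE.
    case: ifP => // sTS; rewrite [ext_one _ _ _]ffunE.
    case: eqVneq => [/eqP|]; rewrite ?mulr0 //.
    by rewrite finset.setD_eq0 => ST; rewrite finset.eqEsubset ST sTS in TS.
  rewrite {2}PE !wedge_basis2 // !interior_wedge_vec interior_one raddf0 subr0.
  rewrite wedge_vec1 linearZ /= wedge_vec1.
  rewrite wedgeDl wedgeZl -[- (pairing _ _ *: ext_vec _)]scaleNr wedgeZl scaleNr.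
  by rewrite raddfB /= linearZ /= opprB addrA addrAC.
Qed.

Lemma extpow_supp P k S : homogeneous 2 P -> #|S| != k.*2 ->
  iter k (wedge P) (ext_one R n) S = 0.
Proof.
move=> hP; elim: k S => [|k IH] S Sk /=.
  by rewrite ffunE -cards_eq0 (negbTE Sk).
rewrite ffunE big1 // => A AS.
have [A2|A2] := eqVneq #|A| 2%N; last by rewrite (hP A) // mulr0 mul0r.
rewrite IH ?mulr0 //; apply: contra Sk => /eqP Sk.
by rewrite -(cardsID A S) (finset.setIidPr AS) A2 Sk.
Qed.

Lemma interior_extpow P k al : homogeneous 2 P ->
  interior_product al (iter k.+1 (wedge P) (ext_one R n)) =
  k.+1%:R *: wedge (ext_vec (sharp P al)) (iter k (wedge P) (ext_one R n)).
Proof.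
move=> hP; elim: k => [|k IH].
  by rewrite /= interior_bivector // interior_one raddf0 addr0
    interior_homogeneous2 // scale1r.
rewrite iterS interior_bivector // IH linearZ /= wedge_bivector_vec //.
by rewrite interior_homogeneous2 // [in RHS]mulrS scalerDl scale1r.
Qed.

(** The derivation rule for an exponential, applied term by term through [interior_extpow]. *)
Lemma interior_exp P al : homogeneous 2 P ->
  interior_product al (ext_exp P) = wedge (ext_vec (sharp P al)) (ext_exp P).
Proof.
move=> hP; rewrite /ext_exp !raddf_sum /= big_ord_recl [in RHS]big_ord_recr /=.
(* The term k = 0 vanishes on the left. The term k = n vanishes on the right, since its degree 2n +
   1 exceeds n. The others match after a shift, because (k + 1) / (k + 1)! = 1 / k!. *)
rewrite linearZ /= interior_one scaler0 add0r [X in _ = _ + X](_ : _ = 0) ?addr0.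
  apply: eq_bigr => i _; rewrite !linearZ /= -/(iter i.+1 _ _) interior_extpow //.
  rewrite /bump /= add1n factS natrM invfM scalerA mulrAC mulVf ?mul1r //.
rewrite linearZ /= (_ : wedge _ _ = 0) ?scaler0 //.
apply/ffunP => S; rewrite ext0 wedge_vecE big1 // => i iS.
rewrite extpow_supp ?mulr0 //; apply: contraL (max_card (mem S)) => /eqP.
rewrite /toggle iS card_ord => E; rewrite -ltnNge (cardsD1 i S) iS E; lia.
Qed.

Lemma ext_exp0 P : homogeneous 2 P -> ext_exp P finset.set0 = 1.
Proof.
move=> hP.
rewrite ext_sum big_ord_recl /= extZ ffunE eqxx fact0 invr1 mulr1.
rewrite big1 ?addr0 // => i _; rewrite extZ [X in _ * X](_ : _ = 0) ?mulr0 //.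
by rewrite -/(iter i.+1 _ _) extpow_supp // cards0.
Qed.

(** By [interior_exp] the action of u on exp(-P) is the wedge with the single vector
    [u.1 - sharp P u.2]. *)
Lemma clifford_exp P u : homogeneous 2 P ->
  clifford u (ext_exp (- P)) = 0 <-> u.1 = sharp P u.2.
Proof.
move=> hP; have hN : homogeneous 2 (- P) by move=> S hS; rewrite extN hP ?oppr0.
rewrite /clifford interior_exp // -wedgeDl.
have -> : ext_vec u.1 + ext_vec (sharp (- P) u.2) =
    ext_vec (u.1 - sharp P u.2) :> ext R n.
  apply/ffunP => S; rewrite extD !ffunE -big_split; apply: eq_bigr => i _ /=.
  by rewrite !mxE raddfN extN.
split=> [E|->]; last by rewrite subrr ext_vec0 wedge0l.
apply/eqP; rewrite -subr_eq0; apply/eqP/rowP => i.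
(* In degree one only the degree 0 part of the exponential contributes, and that part is 1. *)
have := congr1 (fun a : ext R n => a [set i]%SET) E.
rewrite /= ext0 wedge_vecE big_set1 /toggle !inE eqxx.
rewrite (_ : ([set i] :\ i)%SET = finset.set0); last by rewrite finset.setDv.
rewrite ext_exp0 // mulr1 => /eqP; rewrite mulf_eq0 => /orP[|/eqP ->]; last by rewrite mxE.
by rewrite /ext_sign signr_eq0.
Qed.

(* Contraction with a covector expresses each component through components of
   lower degree. *)
Lemma graph_spinor0 P a : (forall al, clifford (sharp P al, al) a = 0) ->
  a finset.set0 = 0 -> a = 0.
Proof.
move=> aP a0; apply/ffunP => S; rewrite ext0.
have [m] := ubnP #|S|; elim: m => // m IH in S *; rewrite ltnS => Sm.
have [->|[i iS]] := set_0Vmem S; first exact: a0.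
have := congr1 (fun a : ext R n => a (toggle i S)) (aP (delta_mx 0 i)).
rewrite /= ext0 cliffordE (bigD1 i) //= big1 ?addr0 => [|j ji].
  rewrite toggleK in_toggle eqxx iS /= mxE !eqxx mulr1 => /eqP.
  by rewrite mulf_eq0 => /orP[|/eqP //]; rewrite /ext_sign signr_eq0.
case: ifPn => jT; last by rewrite mxE (negbTE ji) andbF mulr0 mul0r.
rewrite IH ?mulr0 //; apply: leq_ltn_trans (_ : #|toggle i S| < m)%N.
  by rewrite {1}/toggle jT; apply/subset_leq_card/finset.subsetDl.
by move: Sm; rewrite /toggle iS (cardsD1 i) iS.
Qed.

(** The graph annihilates only a line of spinors: subtracting the multiple of exp(-P) with the same
    degree 0 part leaves an element to which [graph_spinor0] applies. *)
Lemma graph_spinor P a : homogeneous 2 P ->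
  (forall al, clifford (sharp P al, al) a = 0) ->
  a = a finset.set0 *: ext_exp (- P).
Proof.
move=> hP aP; apply/eqP; rewrite -subr_eq0; apply/eqP.
apply: (@graph_spinor0 P) => [al|]; last first.
  rewrite extD extN extZ ext_exp0 ?mulr1 ?subrr // => S hS.
  by rewrite extN hP ?oppr0.
by rewrite raddfB /= linearZ /= aP (_ : clifford _ (ext_exp _) = 0) ?scaler0 ?subrr //;
  apply/clifford_exp.
Qed.

Lemma pair_sumE I (r : seq I) (F G : I -> 'rV[R]_n) :
  (\sum_(i <- r) F i, \sum_(i <- r) G i) = \sum_(i <- r) (F i, G i).
Proof.
rewrite [RHS]surjective_pairing; congr (_, _); elim: r => [|i r IH];
by rewrite ?big_nil // !big_cons IH.
Qed.

(** Nondegeneracy of the pairing. The values of phi on basis covectors form the vector part of t,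
    and those on basis vectors its covector part. *)
Lemma dual_pairing (phi : 'rV[R]_n * 'rV[R]_n -> R) : linear_for *%R phi ->
  exists t, forall u, phi u = pairing u.1 t.2 + pairing t.1 u.2.
Proof.
move=> lphi.
have phi0 : phi 0 = 0 by have := lphi (-1) 0 0; rewrite scaler0 addr0 mulN1r addNr.
have phiD u u' : phi (u + u') = phi u + phi u'.
  by have := lphi 1 u u'; rewrite scale1r mul1r.
have phiZ k u : phi (k *: u) = k * phi u.
  by have := lphi k u 0; rewrite phi0 !addr0.
have phiS (c : 'I_n -> R) (F : 'I_n -> 'rV[R]_n * 'rV[R]_n) :
    phi (\sum_i c i *: F i) = \sum_i c i * phi (F i).
  by elim/big_rec2: _ => // i x y _ <-; rewrite phiD phiZ.
exists (\row_i phi (0, delta_mx 0 i), \row_i phi (delta_mx 0 i, 0)) => -[v al] /=.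
have -> : (v, al) = \sum_i v 0 i *: (delta_mx 0 i, 0) +
                    \sum_i al 0 i *: (0, delta_mx 0 i) :> 'rV[R]_n * 'rV[R]_n.
  rewrite -!pair_sumE -(row_sum_delta v) -(row_sum_delta al).
  by under eq_bigr do rewrite scaler0; under [X in _ + (X, _)]eq_bigr do rewrite scaler0;
    rewrite big1 // /GRing.add /= /add_pair /= addr0 add0r.
rewrite phiD !phiS /pairing; congr (_ + _); apply: eq_bigr => i _; rewrite mxE //.
exact: mulrC.
Qed.

Lemma clifford_foldr (t : 'rV[R]_n * 'rV[R]_n) (s : seq ('rV[R]_n * 'rV[R]_n)) :
  (forall w : 'rV[R]_n * 'rV[R]_n, w \in s -> pairing w.1 t.2 + pairing t.1 w.2 = 0) ->
  exists e : R, forall a, clifford t (foldr clifford a s) =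
    e *: foldr clifford (clifford t a) s.
Proof.
elim: s => [_|w s IH ts] /=; first by exists 1 => a; rewrite scale1r.
have [w' w's|e eE] := IH; first by apply: ts; rewrite inE w's orbT.
exists (- e) => a; have := clifford_anticomm t w (foldr clifford a s).
rewrite [X in X *: _]addrC ts ?inE ?eqxx // scale0r => /eqP; rewrite addr_eq0 => /eqP E.
by rewrite scaleNr -linearZ -eE E.
Qed.

(* Contracting with a vector dual to the first factor, and orthogonal to the
   others, removes the first factor. *)
Lemma clifford_product_neq0 (s : seq ('rV[R]_n * 'rV[R]_n)) : free s ->
  exists a, foldr clifford a s <> 0.
Proof.
elim: s => [_|u s IH us] /=.
  exists (ext_one R n) => /ffunP/(_ finset.set0)/eqP.
  by rewrite ffunE ext0 eqxx oner_eq0.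
have [a a0] : exists a, foldr clifford a s <> 0.
  by apply: IH; apply: (catr_free (X := [:: u])).
(* The coordinate along u in the free family [u :: s] is represented by t: it pairs to 1 with u and
   to 0 with every element of s. *)
have [t tE] := @dual_pairing _ (linearP (coord (in_tuple (u :: s)) ord0)).
have tX (i : 'I_(size s).+1) : pairing ((u :: s)`_i).1 t.2 +
    pairing t.1 ((u :: s)`_i).2 = (i == ord0)%:R.
  by rewrite -tE -(coord_free (X := in_tuple (u :: s)) i ord0).
have [w|e eE] := clifford_foldr (t := t) (s := s).
  move=> /(nthP 0)[i si <-].
  by have := tX (Ordinal (si : (i.+1 < (size s).+1)%N)).
apply: contrapT => /forallNP H; apply: a0.
have {}H b : clifford u (foldr clifford b s) = 0.
  by apply: contrapT; exact: H.
(* If u killed every product over s, both terms of the relation would vanish, the second because t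
   moves past s and acts on a instead. The right side is the nonzero product itself. *)
have := clifford_anticomm t u (foldr clifford a s).
rewrite H raddf0 add0r eE linearZ /= H scaler0 [X in X *: _]addrC.
by have /= -> := tX ord0; rewrite scale1r.
Qed.

End Bivector.

(** * Linear maps acting on the exterior algebra *)

Section ExtMap.
Context {R : realType} {n : nat}.
Implicit Types (S T : {set 'I_n}) (a b P : ext R n) (v w al be : 'rV[R]_n)
  (u : 'rV[R]_n * 'rV[R]_n) (A B : 'M[R]_n).

Lemma ext_map_linear A : linear (@ext_map R n A).
Proof.
move=> k a b; rewrite /ext_map scaler_sumr -big_split /=.
by apply: eq_bigr => S _; rewrite extD extZ scalerDl scalerA.
Qed.

HB.instance Definition _ A :=
  GRing.isLinear.Build R (ext R n) (ext R n) _ (ext_map A) (ext_map_linear A).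

Lemma ext_map_basis A S :
  ext_map A (ext_basis S) = \big[@wedge R n/ext_one R n]_(i in S) ext_vec (row i A).
Proof.
rewrite /ext_map (bigD1 S) //= ext_basisE eqxx scale1r big1 ?addr0 // => T TS.
by rewrite ext_basisE (negbTE TS) scale0r.
Qed.

Lemma ext_map_one A : ext_map A (ext_one R n) = ext_one R n.
Proof. by rewrite (ext_map_basis A finset.set0) big_set0. Qed.

Lemma wedge_big_in (x : 'I_n -> 'rV[R]_n) (r : seq 'I_n) S i :
  i \in r -> i \in S ->
  wedge (ext_vec (x i)) (\big[@wedge R n/ext_one R n]_(k <- r | k \in S) ext_vec (x k)) = 0.
Proof.
move=> + iS; elim: r => // k r IH; rewrite inE big_cons => /predU1P[<-|ir].
  by rewrite iS wedge_vec_sqr.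
by case: ifP => _; rewrite ?IH // wedge_vecC IH // raddf0 oppr0.
Qed.

(** The new factor moves right to its place in the increasing product and picks up one sign for each
    index of [S] below i. Sortedness of [r] ensures that no such index comes later. *)
Lemma wedge_big_notin (x : 'I_n -> 'rV[R]_n) (r : seq 'I_n) S i :
  sorted (fun k l : 'I_n => (k < l)%N) r -> i \in r -> i \notin S ->
  wedge (ext_vec (x i)) (\big[@wedge R n/ext_one R n]_(k <- r | k \in S) ext_vec (x k)) =
  (-1) ^+ count (fun k => (k \in S) && (k < i)%N) r *:
  \big[@wedge R n/ext_one R n]_(k <- r | k \in (i |: S)%SET) ext_vec (x k).
Proof.
move=> + + iS; elim: r => // k r IH kr; rewrite inE !big_cons /= !inE.
have tr : transitive (fun k l : 'I_n => (k < l)%N) by move=> ? ? ?; exact: ltn_trans.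
have [ik _|nik /= ir] := eqVneq i k; first subst k.
  rewrite (negbTE iS) /= add0n.
  have ltr := allP (order_path_min tr kr).
  rewrite (_ : count _ _ = 0%N) ?scale1r.
    congr (wedge _ _); rewrite big_seq_cond [RHS]big_seq_cond.
    apply: eq_bigl => l; rewrite !inE; case: (boolP (l \in r)) => //= lr.
    by case: (eqVneq l i) => // E; move: (ltr l lr); rewrite E /= ltnn.
  apply/eqP; rewrite -leqn0 leqNgt -has_count; apply/negP => /hasP[l lr].
  by move/andP=> [_ li]; have := ltn_trans li (ltr l lr); rewrite ltnn.
have ltr := allP (order_path_min tr kr).
have IHr := IH (path_sorted kr) ir.
case: ifPn => kS /=; last by rewrite add0n IHr.
rewrite (ltr i ir) exprS /= wedge_vecC IHr linearZ /= -scaleN1r scalerA.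
by [].
Qed.

Lemma sorted_index_enum_ord : sorted (fun k l : 'I_n => (k < l)%N) (index_enum 'I_n).
Proof.
rewrite [index_enum _]unlock -enumT.
by have := iota_ltn_sorted 0 n; rewrite -val_enum_ord sorted_map.
Qed.

Lemma ext_map_vec A v a :
  ext_map A (wedge (ext_vec v) a) = wedge (ext_vec (v *m A)) (ext_map A a).
Proof.
have row_sum (F : 'I_n -> 'rV[R]_n) (c : 'I_n -> R) b :
    wedge (ext_vec (\sum_i c i *: F i)) b = \sum_i c i *: wedge (ext_vec (F i)) b.
  have E : (\sum_i c i *: F i, 0 : 'rV[R]_n) = \sum_i c i *: (F i, 0).
    transitivity (\sum_i (c i *: F i, c i *: (0 : 'rV[R]_n))) => //.
    by rewrite -pair_sumE; congr (_, _); rewrite big1 // => i _; exact: scaler0.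
  rewrite -clifford_vec E clifford_suml; apply: eq_bigr => i _.
  by rewrite cliffordZl clifford_vec.
rewrite {1}(row_sum_delta v) mulmx_sum_row !row_sum raddf_sum /=.
apply: eq_bigr => i _; rewrite linearZ /=; congr (_ *: _).
rewrite (ext_decomp a); elim/big_rec: _ => [|S b _ IH]; first by rewrite !raddf0.
rewrite !(linearD, linearZ) /= IH; congr (_ *: _ + _).
rewrite !ext_map_basis.
(* For i in S both sides vanish because of a repeated factor; otherwise both insertions produce the
   same sign. *)
have [iS|iS] := boolP (i \in S).
  rewrite (wedge_big_in (fun k => row k A)) ?mem_index_enum //.
  rewrite (_ : wedge (ext_vec (delta_mx 0 i)) (ext_basis S) = 0) ?raddf0 //.
  apply/ffunP => T; rewrite wedge_deltaE ext0; case: ifP => // iT.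
  rewrite ext_basisE toggle_eq; case: eqVneq => [E|_]; rewrite ?mulr0 //.
  by move: iT; rewrite E in_toggle eqxx iS.
rewrite wedge_delta_basis // linearZ /= ext_map_basis.
rewrite (wedge_big_notin (fun k => row k A)) ?sorted_index_enum_ord ?mem_index_enum //.
congr (_ *: _); rewrite /ext_sign; congr (_ ^+ _).
by rewrite -sum1_count -sum1_card; apply: eq_bigl => k; rewrite inE.
Qed.

Lemma ext_map0 A a : ext_map A a finset.set0 = a finset.set0.
Proof.
move: a; apply: ext_ind => [|k a b ha hb|i a _]; first by rewrite ext_map_one.
  by rewrite linearD linearZ !extD !extZ ha hb.
by rewrite ext_map_vec !wedge_vecE !big_set0.
Qed.

Lemma ext_map_comp A B a : ext_map B (ext_map A a) = ext_map (A *m B) a.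
Proof.
move: a; apply: ext_ind => [|k a b ha hb|i a ha]; first by rewrite !ext_map_one.
  by rewrite !(linearD, linearZ) /= ha hb.
by rewrite !ext_map_vec ha mulmxA.
Qed.

Lemma ext_map_id a : ext_map 1%:M a = a.
Proof.
move: a; apply: ext_ind => [|k a b ha hb|i a ha]; first by rewrite !ext_map_one.
  by rewrite !(linearD, linearZ) /= ha hb.
by rewrite !ext_map_vec ha mulmx1.
Qed.

Lemma pairing_mulmx v A be : pairing (v *m A) be = pairing v (be *m A^T).
Proof.
rewrite /pairing; under eq_bigr do rewrite mxE mulr_suml.
rewrite exchange_big /=; apply: eq_bigr => i _.
by rewrite mxE mulr_sumr; apply: eq_bigr => j _; rewrite mxE; ring.
Qed.

Lemma interior_ext_map A be a :
  interior_product be (ext_map A a) = ext_map A (interior_product (be *m A^T) a).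
Proof.
move: a; apply: ext_ind => [|k a b ha hb|i a ha].
- by rewrite ext_map_one !interior_one raddf0.
- by rewrite !(linearD, linearZ) /= ha hb.
- rewrite ext_map_vec !interior_wedge_vec ha raddfB /= linearZ /= ext_map_vec.
  by rewrite pairing_mulmx.
Qed.

(** Equivariance of the action under a change of basis: B is the inverse of A, so the covector
    transforms contragrediently and the pairing is preserved. *)
Lemma clifford_ext_map A B u a : A *m B = 1%:M ->
  clifford (u.1 *m A, u.2 *m B^T) (ext_map A a) = ext_map A (clifford u a).
Proof.
move=> AB; rewrite /clifford /= interior_ext_map -ext_map_vec linearD /=.
by rewrite -mulmxA -trmx_mul AB trmx1 mulmx1.
Qed.

Lemma sharp_ext_map A P be : homogeneous 2 P ->
  sharp (ext_map A P) be = sharp P (be *m A^T) *m A.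
Proof.
move=> hP; rewrite {1}/sharp interior_ext_map interior_homogeneous2 //.
rewrite -[ext_vec _]wedge_vec1 ext_map_vec ext_map_one wedge_vec1.
apply/rowP => i; rewrite mxE ffunE (big_pred1 i) // => j.
by rewrite /= (inj_eq finset.set1_inj) eq_sym.
Qed.

(** The antisymmetric matrix of P. A bivector is stored by unordered pairs, so the sign restores the
    order of i and j. *)
Definition bivector_mx P : 'M[R]_n :=
  \matrix_(i, j) (if i == j then 0 else (-1) ^+ (j < i)%N * P [set i; j]%SET).

Lemma sharpE P al : sharp P al = al *m bivector_mx P.
Proof.
apply/rowP => j; rewrite !mxE interiorE big_mkcond; apply: eq_bigr => i _.
rewrite mxE inE; case: eqVneq => [->|ij]; rewrite ?mulr0 //=.
rewrite /toggle inE (negbTE ij) mulrCA mulrA; congr (_ * _ * _).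
rewrite /ext_sign; congr (_ ^+ _).
have [ji|ji] := boolP (j < i)%N.
  rewrite (_ : [set k in _ | _]%SET = [set j]%SET) ?cards1 //.
  by apply/finset.setP => k; rewrite !inE; case: eqVneq => // ->.
rewrite (_ : [set k in _ | _]%SET = finset.set0) ?cards0 //.
by apply/finset.setP => k; rewrite !inE; case: eqVneq => // ->; exact: negbTE.
Qed.

Lemma bivector_mx_antisym P i j : bivector_mx P i j = - bivector_mx P j i.
Proof.
rewrite !mxE eq_sym; case: eqVneq => [_|]; rewrite ?oppr0 // finset.setUC.
by case: ltngtP => [||/val_inj ->]; rewrite ?eqxx //= => _ _; ring.
Qed.

Lemma bivector_mx_map A P : homogeneous 2 P ->
  bivector_mx (ext_map A P) = A^T *m bivector_mx P *m A.
Proof.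
move=> hP; apply/row_matrixP => i.
by rewrite !rowE -sharpE sharp_ext_map // sharpE !mulmxA.
Qed.

End ExtMap.

(** * Smooth functions on open sets *)

Lemma differentiable_eq_near (R : realType) (V W : normedModType R)
    (F G : V -> W) (z : V) :
  (\near z, F z = G z) -> differentiable F z -> differentiable G z.
Proof.
move=> FG dF; have Fz : F z = G z by exact: nbhs_singleton FG.
move: FG; rewrite (near_shift 0) subr0 => FG.
have [cd /eqaddoP dE] := (diff_locallyP z F).1 dF.
have E : G \o shift z = cst (G z) + 'd F z +o_ 0 id.
  apply/eqaddoP => e e0; have := dE e e0; apply: filterS2 FG => h /= FG.
  by rewrite /GRing.add /= /GRing.opp /= /cst /= FG Fz.
have dG : 'd G z = 'd F z :> (V -> W) by exact: diff_unique.
by apply/diff_locallyP; rewrite dG.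
Qed.

Lemma near_eq_continuous (T U : topologicalType) (F G : T -> U) (z : T) :
  (\near z, F z = G z) -> {for z, continuous F} -> {for z, continuous G}.
Proof.
move=> FG cF A; rewrite -(nbhs_singleton FG) => /cF.
by apply: filterS2 FG => y /= <-.
Qed.

Section Calculus.
Context {R : realType} {n : nat}.
Implicit Types (W : set 'rV[R]_n) (f g : 'rV[R]_n -> R) (z v : 'rV[R]_n)
  (phi : 'rV[R]_n -> 'rV[R]_n).

Lemma Ck_sub k W W' f : W' `<=` W -> Ck_on k W f -> Ck_on k W' f.
Proof.
elim: k f => [|k IH] f sW /=; first by move=> fW z /sW; exact: fW.
by move=> [df Df]; split=> [z /sW|v]; [exact: df|exact: IH (Df v)].
Qed.

Lemma open_near W (Q : 'rV[R]_n -> Prop) z : open W -> W z ->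
  (forall y, W y -> Q y) -> \near z, Q z.
Proof. by move=> oW Wz WQ; apply: filterS (open_nbhs_nbhs (conj oW Wz)). Qed.

Lemma Ck_eq k W f g : open W -> (forall z, W z -> f z = g z) ->
  Ck_on k W f -> Ck_on k W g.
Proof.
move=> oW; elim: k f g => [|k IH] f g fg /=.
  move=> cf z Wz; have fgz := open_near oW Wz fg.
  exact: near_eq_continuous fgz (cf z Wz).
move=> [df Df]; split=> [z Wz|v].
  by apply: differentiable_eq_near (df z Wz); exact (open_near oW Wz fg).
apply: IH (Df v) => z Wz; apply: near_eq_derive; exact (open_near oW Wz fg).
Qed.

Lemma differentiable_rV phi z :
  (forall j, differentiable (fun y => phi y 0 j) z) -> differentiable phi z.
Proof.
move=> dphi.
have -> : phi = \sum_(j < n) (fun y => phi y 0 j *: (delta_mx 0 j : 'rV[R]_n)).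
  by apply/funext => y; rewrite fct_sumE [LHS]row_sum_delta.
by apply: differentiable_sum => j; apply: differentiableZl.
Qed.

Lemma derive_coord phi z v j : differentiable phi z ->
  'D_v (fun y => phi y 0 j) z = 'D_v phi z 0 j.
Proof.
move=> dphi.
have dc := @differentiable_coord R 1 n (phi z) 0 j.
pose co (M : 'rV[R]_n) : R := M 0 j.
have lco : linear co by move=> k M N; rewrite /co !mxE.
pose colM := GRing.isLinear.Build _ _ _ _ _ lco.
pose coL : {linear _ -> _} := HB.pack co colM.
rewrite !deriveE //; last by apply: (@differentiable_comp _ _ _ _ phi co).
rewrite (_ : (fun y => phi y 0 j) = coL \o phi) // diff_comp //.
by rewrite [LHS]/= (_ : 'd coL (phi z) = coL :> (_ -> _)) //; apply: diff_lin;
  exact: coord_continuous.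
Qed.

Lemma jacobianE phi z i j : differentiable phi z ->
  jacobian phi z i j = 'D_(delta_mx 0 i) (fun y => phi y 0 j) z.
Proof.
move=> dphi; rewrite derive_coord // deriveEjacobian //.
by rewrite -rowE [RHS]mxE.
Qed.

Lemma derive_sum_delta (V : normedModType R) (F : 'rV[R]_n -> V) z v :
  differentiable F z -> 'D_v F z = \sum_j v 0 j *: 'D_(delta_mx 0 j) F z.
Proof.
move=> dF; rewrite deriveE // {1}(row_sum_delta v) raddf_sum /=.
by apply: eq_bigr => j _; rewrite linearZ deriveE.
Qed.

End Calculus.

Section CalculusB.
Context {R : realType} {n : nat}.
Implicit Types (W : set 'rV[R]_n) (f g : 'rV[R]_n -> R) (z v : 'rV[R]_n)
  (phi : 'rV[R]_n -> 'rV[R]_n).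

Lemma derive_comp (V : normedModType R) (F : 'rV[R]_n -> V) phi z v :
  differentiable phi z -> differentiable F (phi z) ->
  'D_v (F \o phi) z = 'D_('D_v phi z) F (phi z).
Proof.
move=> dphi dF; have dc := differentiable_comp dphi dF.
apply: etrans (deriveE v dc) _.
apply: etrans (congr1 (@^~ v) (diff_comp dphi dF)) _.
apply: etrans (esym (deriveE _ dF)) _.
by rewrite (deriveE v dphi).
Qed.

Lemma Ck_S k W f : Ck_on k.+1 W f -> Ck_on k W f.
Proof.
elim: k f => [|k IH] f [df Df]; first by move=> z /df; exact: differentiable_continuous.
by split=> // v; exact: IH.
Qed.

Lemma Ck_cst k W (r : R) : Ck_on k W (fun=> r).
Proof.
elim: k r => [|k IH] r /=; first by move=> z _; exact: cst_continuous.
split=> [z _|v]; first exact: differentiable_cst.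
have -> : 'D_v (fun=> r) = (fun=> 0) :> ('rV[R]_n -> R).
  by apply/funext => z; exact: derive_cst.
exact: IH.
Qed.

Lemma CkD k W f g : open W -> Ck_on k W f -> Ck_on k W g ->
  Ck_on k W (fun z => f z + g z).
Proof.
move=> oW; elim: k f g => [|k IH] f g.
  by move=> cf cg z Wz; exact: (continuousD (cf z Wz) (cg z Wz)).
move=> [df Df] [dg Dg]; split=> [z Wz|v].
  by apply: differentiableD; [exact: df|exact: dg].
apply: Ck_eq (IH _ _ (Df v) (Dg v)) => // z Wz.
by rewrite deriveD //; apply: diff_derivable; [exact: df|exact: dg].
Qed.

Lemma CkM k W f g : open W -> Ck_on k W f -> Ck_on k W g ->
  Ck_on k W (fun z => f z * g z).
Proof.
move=> oW; elim: k f g => [|k IH] f g.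
  by move=> cf cg z Wz; exact: (continuousM (cf z Wz) (cg z Wz)).
move=> Cf Cg; have [[df Df] [dg Dg]] := (Cf, Cg); split=> [z Wz|v].
  by apply: differentiableM; [exact: df|exact: dg].
have := CkD oW (IH _ _ (Ck_S Cf) (Dg v)) (IH _ _ (Ck_S Cg) (Df v)).
apply: Ck_eq => // z Wz.
by rewrite deriveM //; apply: diff_derivable; [exact: df|exact: dg].
Qed.

Lemma smooth_continuous W f z : smooth_on W f -> W z -> {for z, continuous f}.
Proof. by move=> /(_ 0%N); exact. Qed.

Lemma smooth_differentiable W f z : smooth_on W f -> W z -> differentiable f z.
Proof. by move=> /(_ 1%N)[+ _]; exact. Qed.

Lemma smooth_derive W f v : smooth_on W f -> smooth_on W ('D_v f).
Proof. by move=> sf k; have [_] := sf k.+1; exact. Qed.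

Lemma smooth_sub W W' f : W' `<=` W -> smooth_on W f -> smooth_on W' f.
Proof. by move=> sW sf k; exact: Ck_sub (sf k). Qed.

Lemma smooth_eq W f g : open W -> (forall z, W z -> f z = g z) ->
  smooth_on W f -> smooth_on W g.
Proof. by move=> oW fg sf k; exact: Ck_eq (sf k). Qed.

Lemma smooth_cst W (r : R) : smooth_on W (fun=> r).
Proof. by move=> k; exact: Ck_cst. Qed.

Lemma smoothD W f g : open W -> smooth_on W f -> smooth_on W g ->
  smooth_on W (fun z => f z + g z).
Proof. by move=> oW sf sg k; exact: CkD. Qed.

Lemma smoothM W f g : open W -> smooth_on W f -> smooth_on W g ->
  smooth_on W (fun z => f z * g z).
Proof. by move=> oW sf sg k; exact: CkM. Qed.

Lemma smoothN W f : open W -> smooth_on W f -> smooth_on W (fun z => - f z).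
Proof.
move=> oW sf; have := smoothM oW (smooth_cst W (-1)) sf.
by apply: smooth_eq => // z _; rewrite mulN1r.
Qed.

Lemma smooth_sum I (r : seq I) (Q : pred I) (F : I -> 'rV[R]_n -> R) W :
  open W -> (forall i, Q i -> smooth_on W (F i)) ->
  smooth_on W (fun z => \sum_(i <- r | Q i) F i z).
Proof.
move=> oW sF; elim: r => [|i r IH].
  by under eq_fun do rewrite big_nil; exact: smooth_cst.
under eq_fun do rewrite big_cons.
by have [Qi|//] := boolP (Q i); exact: smoothD (sF i Qi) IH.
Qed.

Lemma smooth_prod I (r : seq I) (Q : pred I) (F : I -> 'rV[R]_n -> R) W :
  open W -> (forall i, Q i -> smooth_on W (F i)) ->
  smooth_on W (fun z => \prod_(i <- r | Q i) F i z).
Proof.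
move=> oW sF; elim: r => [|i r IH].
  by under eq_fun do rewrite big_nil; exact: smooth_cst.
under eq_fun do rewrite big_cons.
by have [Qi|//] := boolP (Q i); exact: smoothM (sF i Qi) IH.
Qed.

Lemma smooth_rV_differentiable W phi z :
  (forall j, smooth_on W (fun y => phi y 0 j)) -> W z -> differentiable phi z.
Proof.
by move=> sp Wz; apply: differentiable_rV => j; exact: smooth_differentiable Wz.
Qed.

(** Induction on the order with f generalized: by the chain rule a derivative of the composite is a
    sum of products of a derivative of phi_j with (D_j f) o phi, and D_j f is again smooth. *)
Lemma smooth_comp W W' f phi : open W -> (forall z, W z -> W' (phi z)) ->
  (forall j, smooth_on W (fun z => phi z 0 j)) -> smooth_on W' f ->
  smooth_on W (f \o phi).
Proof.
move=> oW WW' sphi + k; elim: k f => [|k IH] f sf.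
  move=> z Wz; apply: continuous_comp.
    exact/differentiable_continuous/(smooth_rV_differentiable sphi Wz).
  exact: smooth_continuous sf (WW' _ Wz).
have dphi z Wz := smooth_rV_differentiable (z := z) sphi Wz.
split=> [z Wz|v].
  apply: differentiable_comp; first exact: dphi.
  exact: smooth_differentiable sf (WW' _ Wz).
apply: (@Ck_eq _ _ _ _ (fun z => \sum_j 'D_v (fun y => phi y 0 j) z *
   ('D_(delta_mx 0 j) f \o phi) z)) => // [z Wz|].
  have df := smooth_differentiable sf (WW' _ Wz).
  rewrite (derive_comp _ (dphi z Wz) df) (derive_sum_delta _ df).
  by apply: eq_bigr => j _; rewrite (derive_coord _ _ (dphi z Wz)).
rewrite (_ : (fun _ => _) = \sum_j ((fun z => 'D_v (fun y => phi y 0 j) z) *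
   ('D_(delta_mx 0 j) f \o phi))); last by apply/funext => z; rewrite fct_sumE.
elim/big_rec: _ => [|j g _ Cg]; first exact: Ck_cst.
apply: CkD => //; apply: CkM => //; first exact: smooth_derive.
exact/IH/smooth_derive.
Qed.

End CalculusB.

Section SmoothFamilies.
Context {R : realType} {n : nat}.
Implicit Types (W : set 'rV[R]_n).

Lemma smooth_det k W (A : 'rV[R]_n -> 'M[R]_k) : open W ->
  (forall i j, smooth_on W (fun z => A z i j)) -> smooth_on W (fun z => \det (A z)).
Proof.
move=> oW sA; apply: smooth_sum => // s _; apply: smoothM => //.
  exact: smooth_cst.
by apply: smooth_prod => // i _.
Qed.

Lemma smooth_adj k W (A : 'rV[R]_n -> 'M[R]_k) i j : open W ->
  (forall i j, smooth_on W (fun z => A z i j)) ->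
  smooth_on W (fun z => (\adj (A z)) i j).
Proof.
move=> oW sA; rewrite (_ : (fun z => _) = fun z => cofactor (A z) j i); last first.
  by apply/funext => z; rewrite mxE.
apply: smoothM => //; first exact: smooth_cst.
apply: smooth_det => // k1 k2.
by rewrite (_ : (fun z => _) = fun z => A z (lift j k1) (lift i k2)) //;
  apply/funext => z; rewrite !mxE.
Qed.

Lemma smooth_mulmx k l m W (A : 'rV[R]_n -> 'M[R]_(k, l))
    (B : 'rV[R]_n -> 'M[R]_(l, m)) i j : open W ->
  (forall i j, smooth_on W (fun z => A z i j)) ->
  (forall i j, smooth_on W (fun z => B z i j)) ->
  smooth_on W (fun z => (A z *m B z) i j).
Proof.
move=> oW sA sB.
rewrite (_ : (fun z => _) = fun z => \sum_l A z i l * B z l j); last first.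
  by apply/funext => z; rewrite mxE.
by apply: smooth_sum => // p _; exact: smoothM.
Qed.

Lemma smooth_clifford W (u : 'rV[R]_n -> 'rV[R]_n * 'rV[R]_n)
    (a : 'rV[R]_n -> ext R n) : open W ->
  (forall i, smooth_on W (fun z => (u z).1 0 i)) ->
  (forall i, smooth_on W (fun z => (u z).2 0 i)) ->
  (forall S, smooth_on W (fun z => a z S)) ->
  forall S, smooth_on W (fun z => clifford (u z) (a z) S).
Proof.
move=> oW s1 s2 sa S.
under eq_fun do rewrite cliffordE.
apply: smooth_sum => // i _; apply: smoothM => //; apply: smoothM => //.
  exact: smooth_cst.
by case: (i \in S).
Qed.

Lemma smooth_ext_map W (A : 'rV[R]_n -> 'M[R]_n) (a : 'rV[R]_n -> ext R n) :
  open W -> (forall i j, smooth_on W (fun z => A z i j)) ->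
  (forall S, smooth_on W (fun z => a z S)) ->
  forall S, smooth_on W (fun z => ext_map (A z) (a z) S).
Proof.
move=> oW sA sa S; rewrite /ext_map.
under eq_fun do rewrite ext_sum.
apply: smooth_sum => // T _; under eq_fun do rewrite extZ.
apply: smoothM => //; elim: (index_enum _) S => [|i r IH] S.
  by under eq_fun do rewrite big_nil; exact: smooth_cst.
under eq_fun do rewrite big_cons; case: (i \in T); last exact: IH.
under eq_fun do rewrite -clifford_vec.
apply: smooth_clifford => // j; last by under eq_fun do rewrite mxE; exact: smooth_cst.
by under eq_fun do rewrite mxE; exact: sA.
Qed.

End SmoothFamilies.

(** * Changes of charts *)

Definition transition (R : realType) (n : nat) (T : topologicalType)
  (c d : chart R n T) (z : 'rV[R]_n) : 'rV[R]_n := d (chart_inv c z).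

(* Locked, because comparing two of these Jacobians by unfolding makes
   unification diverge. *)
HB.lock Definition Jtransition (R : realType) (n : nat) (T : topologicalType)
  (c d : chart R n T) (z : 'rV[R]_n) : 'M[R]_n := jacobian (transition c d) z.
HB.lock Definition to_chartL (R : realType) (n : nat) (M : smoothManifold R n)
  (c : chart R n M) (x : M) : 'M[R]_n := to_chart c x.
HB.lock Definition of_chartL (R : realType) (n : nat) (M : smoothManifold R n)
  (c : chart R n M) (x : M) : 'M[R]_n := of_chart c x.

Section Charts.
Context {R : realType} {n : nat} (M : smoothManifold R n).
Implicit Types (c d e : chart R n M) (x : M) (V : set M) (z : 'rV[R]_n).

Lemma chartK c x : chart_dom c x -> chart_inv c (c x) = x.
Proof. by move=> cx; apply: chart_mapK; exact: mem_set. Qed.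

Lemma chart_open_image c V : open V -> open (c @` (chart_dom c `&` V)).
Proof.
move=> oV; have oI := @chart_image_open _ _ _ c.
have := @chart_inv_continuous _ _ _ c; rewrite continuous_open_subspace // => ci.
rewrite openE => _ [x [cx Vx] <-].
have Ix : (c @` chart_dom c) (c x) by exists x.
have nV : nbhs (chart_inv c (c x)) V by rewrite chartK //; exact: open_nbhs_nbhs.
apply: filterS2 (open_nbhs_nbhs (conj oI Ix)) (ci _ (mem_set Ix) _ nV) => z.
by move=> [y cy <-] /=; rewrite chartK // => Vy; exists y.
Qed.

Arguments chart_open_image c [V].

Lemma chart_nbhs c x : chart_dom c x -> forall N, nbhs (c x) N ->
  exists V, [/\ open V, V x, V `<=` chart_dom c & forall y, V y -> N (c y)].
Proof.
move=> cx N nN; have oD := @chart_dom_open _ _ _ c.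
have := @chart_continuous _ _ _ c.
rewrite continuous_open_subspace // => /(_ x (mem_set cx) _ nN) cN.
have : nbhs x (chart_dom c `&` c @^-1` N).
  by apply: filterI => //; exact: open_nbhs_nbhs.
by rewrite nbhsE => -[V [oV Vx] VN]; exists V; split=> // y /VN [].
Qed.

Lemma transition_smooth c d V j : atlas c -> atlas d -> V `<=` chart_dom d ->
  smooth_on (c @` (chart_dom c `&` V)) (fun z => transition c d z 0 j).
Proof.
move=> ac ad Vd; apply: smooth_sub (atlas_compatible ac ad j).
by apply: image_subset => x [cx /Vd].
Qed.

Lemma transition_differentiable c d x : atlas c -> atlas d ->
  chart_dom c x -> chart_dom d x -> differentiable (transition c d) (c x).
Proof.
move=> ac ad cx dx.
apply: (smooth_rV_differentiable (W := c @` (chart_dom c `&` chart_dom d))).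
  by move=> j; exact: transition_smooth.
by exists x.
Qed.

Lemma Jtransition_comp c d e x : atlas c -> atlas d -> atlas e ->
  chart_dom c x -> chart_dom d x -> chart_dom e x ->
  Jtransition c e (c x) = Jtransition c d (c x) *m Jtransition d e (d x).
Proof.
move=> ac ad ae cx dx ex.
have tx : transition c d (c x) = d x by rewrite /transition chartK.
have dcd := transition_differentiable ac ad cx dx.
have dde := transition_differentiable ad ae dx ex; rewrite -tx in dde.
apply/row_matrixP => i; rewrite !rowE mulmxA.
rewrite -tx Jtransition.unlock; set v := delta_mx 0 i.
apply: etrans (esym (deriveEjacobian v (transition_differentiable ac ae cx ex))) _.
apply: etrans _ (congr1 (mulmx^~ _) (deriveEjacobian v dcd)).
apply: etrans _ (deriveEjacobian _ dde).
apply: etrans _ (derive_comp v dcd dde); apply: near_eq_derive.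
have := chart_open_image c (@chart_dom_open _ _ _ d).
move=> oI; apply: filterS (open_nbhs_nbhs (conj oI _)); last by exists x.
by move=> _ [y [cy dy] <-]; rewrite /transition /= !chartK.
Qed.

Lemma Jtransition_id c x : chart_dom c x -> Jtransition c c (c x) = 1%:M.
Proof.
move=> cx; have E : \forall z \near (c x), z = transition c c z.
  have oI := chart_open_image c openT.
  apply: filterS (open_nbhs_nbhs (conj oI _)); last by exists x.
  by move=> _ [y [cy _] <-]; rewrite /transition chartK.
have did : differentiable (transition c c) (c x).
  exact: differentiable_eq_near E _.
apply/row_matrixP => i; rewrite !rowE mulmx1 Jtransition.unlock.
apply: etrans (esym (deriveEjacobian _ did)) _.
by apply: etrans (esym (near_eq_derive _ E)) _; rewrite derive_id.
Qed.

Lemma to_chartJ c x : to_chartL c x = Jtransition (chart_at x) c (chart_at x x).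
Proof. by rewrite to_chartL.unlock Jtransition.unlock. Qed.

Lemma of_chartJ c x : of_chartL c x = Jtransition c (chart_at x) (c x).
Proof. by rewrite of_chartL.unlock Jtransition.unlock. Qed.

(** [to_chartL c x] need not be continuous in x, as [chart_at x] may jump. Changing c into d only
    multiplies it by the Jacobian of a transition map, which is smooth; this is how smoothness
    passes from one chart to another. *)
Lemma to_chart_trans c d x : atlas c -> atlas d ->
  chart_dom c x -> chart_dom d x ->
  to_chartL d x = to_chartL c x *m Jtransition c d (c x).
Proof.
move=> ac ad cx dx; rewrite !to_chartJ.
exact: (Jtransition_comp (chart_at_atlas x) ac ad (chart_at_dom x)).
Qed.

Lemma of_chart_trans c d x : atlas c -> atlas d ->
  chart_dom c x -> chart_dom d x ->
  of_chartL d x = Jtransition d c (d x) *m of_chartL c x.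
Proof.
move=> ac ad cx dx; rewrite !of_chartJ.
exact: (Jtransition_comp ad ac (chart_at_atlas x) dx cx (chart_at_dom x)).
Qed.

Lemma to_of_chart c x : atlas c -> chart_dom c x ->
  to_chartL c x *m of_chartL c x = 1%:M.
Proof.
move=> ac cx; rewrite to_chartJ of_chartJ -(Jtransition_id (chart_at_dom x)).
apply/esym/Jtransition_comp => //; try exact: chart_at_atlas;
  exact: chart_at_dom.
Qed.

Lemma of_to_chart c x : atlas c -> chart_dom c x ->
  of_chartL c x *m to_chartL c x = 1%:M.
Proof. by move=> ac cx; apply: mulmx1C; exact: to_of_chart. Qed.

Lemma to_chart_at x : to_chartL (chart_at x) x = 1%:M.
Proof. by rewrite to_chartJ; exact/Jtransition_id/chart_at_dom. Qed.

Lemma of_chart_at x : of_chartL (chart_at x) x = 1%:M.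
Proof. by rewrite of_chartJ; exact/Jtransition_id/chart_at_dom. Qed.

Lemma gcoordE c x (u : 'rV[R]_n * 'rV[R]_n) :
  gcoord c x u = (u.1 *m to_chartL c x, u.2 *m (of_chartL c x)^T).
Proof. by rewrite to_chartL.unlock of_chartL.unlock. Qed.

Lemma gcoord_at x (u : 'rV[R]_n * 'rV[R]_n) : gcoord (chart_at x) x u = u.
Proof. by rewrite gcoordE to_chart_at of_chart_at trmx1 !mulmx1; case: u. Qed.

Lemma Jtransition_smooth c d V i j : atlas c -> atlas d -> open V ->
  V `<=` chart_dom d ->
  smooth_on (c @` (chart_dom c `&` V)) (fun z => Jtransition c d z i j).
Proof.
move=> ac ad oV Vd; have oI := chart_open_image c oV.
have := smooth_derive (delta_mx 0 i) (transition_smooth j ac ad Vd).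
apply: smooth_eq => // z [x [cx Vx] <-].
by rewrite Jtransition.unlock jacobianE //; apply: transition_differentiable => //; exact: Vd.
Qed.

Lemma smooth_transition c d V (f : 'rV[R]_n -> R) : atlas c -> atlas d ->
  open V -> V `<=` chart_dom c ->
  smooth_on (c @` (chart_dom c `&` (V `&` chart_dom d))) f ->
  smooth_on (d @` (chart_dom d `&` V)) (fun z => f (transition d c z)).
Proof.
move=> ac ad oV Vc; apply: smooth_comp => [|_ [x [dx Vx] <-]|j].
- exact: chart_open_image.
- by exists x; [split=> //; exact: Vc|rewrite /transition chartK].
- exact: transition_smooth.
Qed.

End Charts.

Arguments chart_open_image {R n M} c [V].

(** * From a Dirac structure to an extended spinor *)

Section Forward.
Context {R : realType} {n : nat} (M : smoothManifold R n).
Implicit Types (c d e : chart R n M) (x y : M) (V : set M) (z : 'rV[R]_n)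
  (u v : 'rV[R]_n * 'rV[R]_n).

Lemma dirac_pairing_eq0 u v :
  (dirac_pairing u v = 0) <-> (pairing u.1 v.2 + pairing v.1 u.2 = 0).
Proof.
rewrite /dirac_pairing; split=> [/eqP|->]; last by rewrite mulr0.
by rewrite mulf_eq0 invr_eq0 pnatr_eq0 /= => /eqP.
Qed.

(** A factor of the product anticommutes with the others by isotropy, so it can be moved to its own
    copy, where its square is zero. Linearity gives the whole span. *)
Lemma clifford_isotropic_foldr (s : seq ('rV[R]_n * 'rV[R]_n)) a :
  (forall u v, u \in s -> v \in s -> dirac_pairing u v = 0) ->
  forall u, u \in << s >>%VS -> clifford u (foldr clifford a s) = 0.
Proof.
move=> iso; have H u : u \in s -> clifford u (foldr clifford a s) = 0.
  elim: s iso u => // w s IH iso u us /=.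
  have := clifford_anticomm u w (foldr clifford a s).
  rewrite (dirac_pairing_eq0 u w).1; last by apply: iso => //; rewrite inE eqxx.
  rewrite scale0r => /eqP E; move: us E; rewrite inE => /predU1P[->|us].
    by rewrite -mulr2n -scaler_nat scaler_eq0 pnatr_eq0 /= => /eqP.
  have -> : clifford u (foldr clifford a s) = 0.
    by apply: IH us => u1 u2 u1s u2s; apply: iso; rewrite inE ?u1s ?u2s orbT.
  by rewrite raddf0 addr0 => /eqP.
move=> u us; rewrite (coord_span (X := in_tuple s) us) clifford_suml big1 // => i _.
by rewrite cliffordZl H ?scaler0 // mem_nth.
Qed.

Lemma clifford_gcoord c x u a : atlas c -> chart_dom c x ->
  clifford (gcoord c x u) (ext_map (to_chartL c x) a) =
  ext_map (to_chartL c x) (clifford u a).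
Proof. by move=> ac cx; rewrite gcoordE clifford_ext_map ?to_of_chart. Qed.

Lemma ext_map_foldr c x (s : seq ('rV[R]_n * 'rV[R]_n)) a :
  atlas c -> chart_dom c x ->
  ext_map (to_chartL c x) (foldr clifford a s) =
  foldr clifford (ext_map (to_chartL c x) a) [seq gcoord c x u | u <- s].
Proof.
by move=> ac cx; elim: s => //= u s IH; rewrite -IH clifford_gcoord.
Qed.

Lemma near_neq0 (T : topologicalType) (f : T -> R) (x : T) :
  {for x, continuous f} -> f x != 0 -> \forall y \near x, f y != 0.
Proof. by move=> cf fx; apply: (cf [set r : R | r != 0]);
  exact: (open_nbhs_nbhs (conj (@open_neq R 0) fx)). Qed.

Lemma smooth_multivector_sub V V' (s : M -> ext R n) : V' `<=` V ->
  smooth_multivector V s -> smooth_multivector V' s.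
Proof.
move=> V'V ss c ac S; apply: smooth_sub (ss c ac S).
by apply: image_subset => x [cx /V'V].
Qed.

Lemma smooth_multivectorE V (s : M -> ext R n) :
  smooth_multivector V s <-> forall c, atlas c -> forall S,
    smooth_on (c @` (chart_dom c `&` V))
      (fun z => ext_map (to_chartL c (chart_inv c z)) (s (chart_inv c z)) S).
Proof. by rewrite to_chartL.unlock. Qed.

(** The starting multivector is constant in the coordinates of [chart_at m]; [of_chartL] rewrites it
    in those of [chart_at x]. Seen in a chart d, the dependence on [chart_at x] cancels and a
    Jacobian of a transition map remains. *)
Lemma smooth_spinor (m : M) V (I : Type) (r : seq I)
    (s : I -> M -> 'rV[R]_n * 'rV[R]_n) a :
  open V -> V `<=` chart_dom (chart_at m) -> (forall i, smooth_gsection V (s i)) ->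
  smooth_multivector V (fun x => foldr clifford
    (ext_map (of_chartL (chart_at m) x) a) [seq s i x | i <- r]).
Proof.
set c := chart_at m => oV Vc ss; apply/smooth_multivectorE => d ad S.
have ac : atlas c by exact: chart_at_atlas.
have oI := chart_open_image d oV.
pose F (r : seq I) z := let x := chart_inv d z in
  foldr clifford (ext_map (Jtransition c d (transition d c z)) a)
    [seq gcoord d x (s i x) | i <- r].
apply: (@smooth_eq _ _ _ (fun z => F r z S)) => //.
  move=> _ [x [dx Vx] <-] /=; rewrite /F chartK //.
  rewrite (ext_map_foldr _ _ ad dx) ext_map_comp -map_comp.
  rewrite (to_chart_trans ac ad (Vc _ Vx) dx) mulmxA of_to_chart ?mul1mx //; last exact: Vc.
  by rewrite /transition chartK.
elim: r S => [|i r IH] S; rewrite /F /=.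
  apply: smooth_ext_map => // [i j|T]; last exact: smooth_cst.
  apply: (smooth_transition (f := fun z => Jtransition c d z i j)) => //.
  by apply: Jtransition_smooth => //; exact: openI (chart_dom_open _).
apply: smooth_clifford => //= j.
  exact: (proj1 (ss i d ad j)).
exact: (ss i d ad j).2.
Qed.

Lemma smooth_multivector_neq0 V (s : M -> ext R n) (m : M) :
  open V -> V m -> smooth_multivector V s -> s m <> 0 ->
  exists V', [/\ open V', V' m, V' `<=` V & forall x, V' x -> s x <> 0].
Proof.
set c := chart_at m => oV Vm /smooth_multivectorE ss sm.
have ac : atlas c by exact: chart_at_atlas.
have cm : chart_dom c m by exact: chart_at_dom.
have [S sS] : exists S, s m S != 0.
  apply: contrapT => /forallNP H; apply: sm; apply/ffunP => S; rewrite ext0.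
  by apply/eqP; apply: contrapT => /negP; exact: H.
have Im : (c @` (chart_dom c `&` V)) (c m) by exists m.
have := near_neq0 (smooth_continuous (ss c ac S) Im).
rewrite /= chartK // to_chart_at ext_map_id => /(_ sS) nS.
have [V' [oV' V'm V'c V'S]] := chart_nbhs cm nS.
exists (V `&` V'); split=> [||x []|x [Vx V'x] sx] //; first exact: openI.
by have := V'S x V'x; rewrite chartK ?sx ?raddf0 ?ext0 ?eqxx //; exact: V'c.
Qed.

Theorem removable_extends (Msing : set M) (Pi : M -> ext R n) (m : M) :
  (forall x, ~ Msing x -> homogeneous 2 (Pi x)) -> removable Msing Pi m ->
  exists (U : set M) (f : M -> R),
    [/\ open U, U m, smooth_fun U f &
      exists sigma : M -> ext R n,
        [/\ smooth_multivector U sigma,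
            forall x, U x -> ~ Msing x ->
              sigma x = (f x : R) *: ext_exp (- Pi x) &
            forall x, U x -> sigma x <> 0]].
Proof.
move=> Pi2 [U [oU Um [sL iso _]]].
have [V [k [s [oV Vm VU ss fr]]]] := sL m Um.
have [/= free_m _] := fr m Vm.
have [tau tau0] := clifford_product_neq0 free_m.
pose sigma x := foldr clifford (ext_map (of_chartL (chart_at m) x) tau)
  [seq s i x | i <- enum 'I_k].
set D := chart_dom (chart_at m).
have oVD : open (V `&` D) by apply: openI => //; exact: chart_dom_open.
have ssigma : smooth_multivector (V `&` D) sigma.
  apply: smooth_spinor => // i c ac j.
  have sI : c @` (chart_dom c `&` (V `&` D)) `<=` c @` (chart_dom c `&` V).
    by apply: image_subset => x [? []].
  have [s1 s2] := ss i c ac j.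
  by split; [exact: smooth_sub sI s1|exact: smooth_sub sI s2].
(* Isotropy holds for the fibres of the closure over singular points as well, so the frame is
   isotropic on all of V. *)
have Lx x u : V x -> closure (graph_of Msing Pi) (x, u) -> clifford u (sigma x) = 0.
  move=> Vx Lu; have [_ /(_ u)[/(_ Lu) uspan _]] := fr x Vx.
  apply: clifford_isotropic_foldr uspan => u1 u2 u1s u2s.
  have [iso1 _] := iso x (VU _ Vx).
  have [_ frx] := fr x Vx.
  by apply: iso1; apply/frx; exact: memv_span.
have sm : sigma m <> 0 by rewrite /sigma of_chart_at ext_map_id.
have [W [oW Wm WVD sW]] := smooth_multivector_neq0 oVD (conj Vm (chart_at_dom m)) ssigma sm.
have sigmaW := smooth_multivector_sub WVD ssigma.
(* The degree 0 component is the same in all charts, by [ext_map0], so it is a smooth function. *)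
exists W, (fun x => sigma x finset.set0); split=> //.
  move=> c ac; have := (smooth_multivectorE _ _).1 sigmaW c ac finset.set0.
  apply: smooth_eq; first exact: chart_open_image.
  by move=> z _; rewrite ext_map0.
exists sigma; split=> // x /WVD[Vx _] nx.
apply: graph_spinor; first exact: Pi2.
by move=> al; apply: Lx => //; exact: subset_closure.
Qed.

End Forward.

(** * Annihilators of spinors *)

Section Annihilator.
Context {R : realType} {n : nat}.
Implicit Types (a : ext R n) (r : 'rV[R]_(n + n)) (u v : 'rV[R]_n * 'rV[R]_n).

(** Elements of V + V* are also written as rows of length 2n, to which ranks and kernels of matrices
    apply. *)
Definition split_row r : 'rV[R]_n * 'rV[R]_n := (lsubmx r, rsubmx r).
Definition join_row u : 'rV[R]_(n + n) := row_mx u.1 u.2.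

Lemma split_rowK r : join_row (split_row r) = r.
Proof. exact: hsubmxK. Qed.

Lemma join_rowK u : split_row (join_row u) = u.
Proof. by case: u => v al; rewrite /split_row row_mxKl row_mxKr. Qed.

Lemma split_row_linear : linear split_row.
Proof. by move=> k r s; rewrite /split_row !linearP. Qed.

HB.instance Definition _ := GRing.isLinear.Build R 'rV[R]_(n + n)
  ('rV[R]_n * 'rV[R]_n)%type _ split_row split_row_linear.

Lemma join_row_linear : linear join_row.
Proof.
by move=> k u v; rewrite -[RHS]split_rowK linearP /= !join_rowK.
Qed.

HB.instance Definition _ := GRing.isLinear.Build R
  ('rV[R]_n * 'rV[R]_n)%type 'rV[R]_(n + n) _ join_row join_row_linear.

(** The matrix of u |-> [clifford u a]; its left kernel is the annihilator of a. *)
Definition spinor_mx a : 'M[R]_(n + n, #|{set 'I_n}|) :=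
  \matrix_(i, j) clifford (split_row (delta_mx 0 i)) a (enum_val j).

Lemma mul_spinor_mx r a : r *m spinor_mx a = 0 <-> clifford (split_row r) a = 0.
Proof.
have E j : (r *m spinor_mx a) 0 j = clifford (split_row r) a (enum_val j).
  rewrite mxE [in RHS](row_sum_delta r) raddf_sum /= clifford_suml ext_sum.
  by apply: eq_bigr => i _; rewrite linearZ cliffordZl extZ mxE.
split=> [H|H]; last by apply/rowP => j; rewrite E H ext0 mxE.
apply/ffunP => S; rewrite ext0 -(enum_rankK S) -E H mxE.
by [].
Qed.

Definition swap_mx : 'M[R]_(n + n) := block_mx 0 1%:M 1%:M 0.

Lemma swap_mxK : swap_mx *m swap_mx = 1%:M.
Proof.
by rewrite mulmx_block !mulmx0 !mul0mx !mul1mx !add0r !addr0 -scalar_mx_block.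
Qed.

(** The Gram matrix of the rows for the pairing, [K *m swap_mx *m K^T], vanishes while [swap_mx] is
    invertible. Hence twice the rank of K is at most 2n. *)
Lemma isotropic_rank k (K : 'M[R]_(k, n + n)) :
  (forall i j, dirac_pairing (split_row (row i K)) (split_row (row j K)) = 0) ->
  (\rank K <= n)%N.
Proof.
move=> iso; have KJK : (K *m swap_mx) *m K^T = 0.
  apply/matrixP => i j; rewrite [RHS]mxE.
  have /dirac_pairing_eq0 <- := iso i j.
  rewrite -{1}[K]hsubmxK mul_row_block !mulmx0 !mulmx1 add0r addr0.
  have -> : K^T = col_mx (lsubmx K)^T (rsubmx K)^T by rewrite -tr_row_mx hsubmxK.
  rewrite mul_row_col mxE addrC /pairing !mxE.
  by congr (_ + _); apply: eq_bigr => l _; rewrite !mxE // mulrC.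
have uJ : swap_mx \in unitmx by case/mulmx1_unit: swap_mxK.
have := mulmx0_rank_max KJK; rewrite mxrankMfree ?row_free_unit // mxrank_tr.
lia.
Qed.

Lemma spinor_isotropic a u v : a <> 0 -> clifford u a = 0 -> clifford v a = 0 ->
  dirac_pairing u v = 0.
Proof.
move=> a0 ua va; apply/dirac_pairing_eq0.
have := clifford_anticomm u v a; rewrite ua va !raddf0 addr0 => /esym/eqP.
by rewrite scaler_eq0 => /orP[/eqP|/eqP].
Qed.

Lemma spinor_mx_rank a : a <> 0 -> (n <= \rank (spinor_mx a))%N.
Proof.
move=> a0; have : (\rank (kermx (spinor_mx a)) <= n)%N.
  apply: isotropic_rank => i j; apply: (spinor_isotropic a0);
  by apply/mul_spinor_mx; rewrite -row_mul mulmx_ker row0.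
by rewrite mxrank_ker; have := rank_leq_row (spinor_mx a); lia.
Qed.

(** Q and B invert the row and column operations that reduce T to normal form, so the product is the
    identity for this T. Being constant matrices, they can be kept when T varies, and the minor
    stays invertible nearby. *)
Lemma minor_of_rank N (T : 'M[R]_(n + n, N)) : (n <= \rank T)%N ->
  exists (Q : 'M[R]_(n + n)) (B : 'M[R]_(N, n)),
    Q \in unitmx /\ usubmx Q *m T *m B \in unitmx.
Proof.
pose J : 'M[R]_(N, n) := pid_mx n.
move=> rT; exists (invmx (col_ebase T)), (invmx (row_ebase T) *m J).
rewrite unitmx_inv col_ebase_unit; split=> //.
have -> : usubmx (invmx (col_ebase T)) *m T *m (invmx (row_ebase T) *m J) =
    usubmx (invmx (col_ebase T) *m T *m invmx (row_ebase T) *m J).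
  by rewrite !mulmxA !mul_usub_mx.
rewrite -{2}(mulmx_ebase T) !mulmxA mulVmx ?col_ebase_unit // mul1mx.
rewrite -(mulmxA _ (row_ebase T)) mulmxV ?row_ebase_unit // mulmx1.
have nN : (n <= N)%N := leq_trans rT (rank_leq_col T).
rewrite /J mul_pid_mx (minn_idPr rT) (minn_idPr nN).
rewrite (_ : usubmx _ = 1%:M) ?unitmx1 //; apply/matrixP => i j.
by rewrite !mxE /= ltn_ord andbT.
Qed.

Section Frame.
Context {N : nat} (T : 'M[R]_(n + n, N)) (Q : 'M[R]_(n + n)) (B : 'M[R]_(N, n)).

Definition minor_mx : 'M[R]_n := usubmx Q *m T *m B.

(** A Schur complement multiplied by the determinant of the minor: its rows lie in the left kernel
    of [T *m B], and form a basis of it when Q and the minor are invertible. Using the adjugate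
    keeps the entries polynomial in T. *)
Definition kernel_frame : 'M[R]_(n, n + n) :=
  \det minor_mx *: dsubmx Q - dsubmx Q *m T *m B *m \adj minor_mx *m usubmx Q.

Context (uQ : Q \in unitmx) (uA : \det minor_mx != 0).

Lemma kernel_frame_free (w : 'rV[R]_n) : w *m kernel_frame = 0 -> w = 0.
Proof.
rewrite /kernel_frame mulmxBr -scalemxAr -!mulmxA !(mulmxA w) => E.
set y := w *m dsubmx Q *m T *m B *m \adj minor_mx.
have : row_mx (- y) (\det minor_mx *: w) *m Q = 0.
  rewrite -{1}[Q]vsubmxK mul_row_col mulNmx -scalemxAl addrC.
  by move: E; rewrite /y !mulmxA.
move/(congr1 (mulmx^~ (invmx Q))); rewrite mulmxK // mul0mx -row_mx0.
case/eq_row_mx => _ /eqP; rewrite scaler_eq0 (negbTE uA) /= => /eqP //.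
Qed.

Lemma kernel_frame_span (r : 'rV[R]_(n + n)) : r *m T *m B = 0 ->
  (r <= kernel_frame)%MS.
Proof.
move=> rT; rewrite -[r](mulmxKV uQ); set s := r *m invmx Q.
have sE : s *m Q = lsubmx s *m usubmx Q + rsubmx s *m dsubmx Q.
  by rewrite -mul_row_col hsubmxK vsubmxK.
(* In coordinates relative to the rows of Q, the equation for r determines the upper n coordinates
   from the lower n, since the minor is invertible. *)
have lE : lsubmx s *m minor_mx = - (rsubmx s *m dsubmx Q *m T *m B).
  apply/eqP; rewrite -addr_eq0 /minor_mx !mulmxA -!mulmxDl -sE.
  by rewrite mulmxKV // rT.
apply/submxP; exists ((\det minor_mx)^-1 *: rsubmx s).
rewrite /kernel_frame mulmxBr -scalemxAl -scalemxAr scalerA mulVf // scale1r sE addrC.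
congr (_ + _); rewrite -scalemxAl -scalerN !mulmxA.
have -> : - (rsubmx s *m dsubmx Q *m T *m B *m \adj minor_mx *m usubmx Q) =
    lsubmx s *m (minor_mx *m \adj minor_mx) *m usubmx Q.
  by rewrite mulmxA lE !mulNmx.
by rewrite mul_mx_adj mul_mx_scalar -scalemxAl scalerA mulVf // scale1r.
Qed.

(* The kernel of [T] is contained in that of [T *m B], and both have rank n. *)
Lemma kernel_frame_full (G : 'M[R]_(n, n + n)) :
  row_free G -> G *m T = 0 -> kernel_frame *m T = 0.
Proof.
move=> fG GT; have GF : (G <= kernel_frame)%MS.
  apply/row_subP => i; apply: kernel_frame_span.
  by rewrite -row_mul GT row0 mul0mx.
have : (kernel_frame <= G)%MS.
  rewrite -(mxrank_leqif_sup GF) eqn_leq mxrankS //=.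
  by rewrite (eqP fG) rank_leq_row.
by case/submxP => X ->; rewrite -mulmxA GT mulmx0.
Qed.

End Frame.
End Annihilator.

Section Families.
Context {K : fieldType} {V : vectType K} {k : nat} (s : 'I_k -> V).

Lemma free_family :
  (forall w : 'rV[K]_k, \sum_i w 0 i *: s i = 0 -> w = 0) ->
  free [seq s i | i <- enum 'I_k].
Proof.
move=> H; have sz : size [seq s i | i <- enum 'I_k] == k by rewrite size_map size_enum_ord.
apply/(freeP (X := Tuple sz)) => w E i.
have /rowP/(_ i) : \row_i w i = 0; last by rewrite !mxE.
apply: H; rewrite -[RHS]E; apply: eq_bigr => j _.
by rewrite mxE (nth_map j) ?size_enum_ord //= nth_ord_enum.
Qed.

Lemma span_family (u : V) : u \in << [seq s i | i <- enum 'I_k] >>%VS <->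
  exists w : 'rV[K]_k, u = \sum_i w 0 i *: s i.
Proof.
split=> [us|[w ->]]; last first.
  apply: memv_suml => i _; apply/memvZ/memv_span/map_f.
  by rewrite mem_enum.
have sz : size [seq s i | i <- enum 'I_k] == k by rewrite size_map size_enum_ord.
exists (\row_i coord (Tuple sz) i u).
rewrite [LHS](coord_span (X := Tuple sz) us); apply: eq_bigr => j _.
by rewrite mxE (nth_map j) ?size_enum_ord //= nth_ord_enum.
Qed.

End Families.

(** * Sections and spinors in chart coordinates *)

Section ChartCoordinates.
Context {R : realType} {n : nat} (M : smoothManifold R n).
Implicit Types (c d e : chart R n M) (x y : M) (V : set M) (z : 'rV[R]_n)
  (u v : 'rV[R]_n * 'rV[R]_n).

Definition gcoord_inv c x u : 'rV[R]_n * 'rV[R]_n :=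
  (u.1 *m of_chartL c x, u.2 *m (to_chartL c x)^T).

Lemma gcoordK c x u : atlas c -> chart_dom c x ->
  gcoord_inv c x (gcoord c x u) = u.
Proof.
move=> ac cx; rewrite gcoordE /gcoord_inv /= -!mulmxA -trmx_mul.
by rewrite to_of_chart // trmx1 !mulmx1; case: u.
Qed.

Lemma gcoord_invK c x u : atlas c -> chart_dom c x ->
  gcoord c x (gcoord_inv c x u) = u.
Proof.
move=> ac cx; rewrite gcoordE /gcoord_inv /= -!mulmxA -trmx_mul.
by rewrite of_to_chart // trmx1 !mulmx1; case: u.
Qed.

Lemma gcoord_linear c x : linear (gcoord c x).
Proof.
by move=> k u v; rewrite /gcoord /= !mulmxDl -!scalemxAl.
Qed.

HB.instance Definition _ c x := GRing.isLinear.Build R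
  ('rV[R]_n * 'rV[R]_n)%type ('rV[R]_n * 'rV[R]_n)%type _ (gcoord c x)
  (gcoord_linear c x).

Lemma ext_map_to_chart_inj c x (a : ext R n) : atlas c -> chart_dom c x ->
  ext_map (to_chartL c x) a = 0 -> a = 0.
Proof.
move=> ac cx /(congr1 (ext_map (of_chartL c x))).
by rewrite ext_map_comp to_of_chart // ext_map_id raddf0.
Qed.

Lemma clifford_gcoord_eq0 c x u a : atlas c -> chart_dom c x ->
  clifford (gcoord c x u) (ext_map (to_chartL c x) a) = 0 <-> clifford u a = 0.
Proof.
move=> ac cx; rewrite clifford_gcoord //.
by split=> [/(ext_map_to_chart_inj ac cx)//|->]; rewrite raddf0.
Qed.

Lemma sharp_gcoord c x (P : ext R n) u : atlas c -> chart_dom c x ->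
  homogeneous 2 P ->
  u.1 = sharp P u.2 <->
  (gcoord c x u).1 = sharp (ext_map (to_chartL c x) P) (gcoord c x u).2.
Proof.
move=> ac cx hP; rewrite gcoordE /= sharp_ext_map // -mulmxA -trmx_mul.
rewrite to_of_chart // trmx1 mulmx1; split=> [->//|].
by move/(congr1 (mulmx^~ (of_chartL c x))); rewrite -!mulmxA to_of_chart // !mulmx1.
Qed.

Lemma smooth_gsection_chart c V (s : 'rV[R]_n -> 'rV[R]_n * 'rV[R]_n) :
  atlas c -> open V -> V `<=` chart_dom c ->
  (forall i, smooth_on (c @` (chart_dom c `&` V)) (fun z => (s z).1 0 i)) ->
  (forall i, smooth_on (c @` (chart_dom c `&` V)) (fun z => (s z).2 0 i)) ->
  smooth_gsection V (fun x => gcoord_inv c x (s (c x))).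
Proof.
move=> ac oV Vc s1 s2 d ad i; have oI := chart_open_image d oV.
have sVd : c @` (chart_dom c `&` (V `&` chart_dom d)) `<=` c @` (chart_dom c `&` V).
  by apply: image_subset => x [? []].
have tr (f : 'rV[R]_n -> R) : smooth_on (c @` (chart_dom c `&` V)) f ->
    smooth_on (d @` (chart_dom d `&` V)) (fun z => f (transition d c z)).
  move=> sf; apply: smooth_transition => //; exact: smooth_sub sf.
split.
  apply: (@smooth_eq _ _ _ (fun z => ((s (transition d c z)).1 *m
      Jtransition c d (transition d c z)) 0 i)) => //.
    move=> _ [x [dx Vx] <-]; lazy beta zeta.
    rewrite gcoordE [RHS]/= /transition !chartK //.
    have cx := Vc _ Vx.
    by rewrite (to_chart_trans ac ad cx dx) mulmxA -(mulmxA _ (of_chartL c x))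
      of_to_chart // mulmx1.
  apply: smooth_mulmx => // j1 j2; first by rewrite ord1; exact: tr (s1 _).
  apply: (smooth_transition (f := fun z => Jtransition c d z j1 j2)) => //.
  by apply: Jtransition_smooth => //; exact: openI (chart_dom_open _).
apply: (@smooth_eq _ _ _ (fun z => ((s (transition d c z)).2 *m
    (Jtransition d c z)^T) 0 i)) => //.
  move=> _ [x [dx Vx] <-]; lazy beta zeta.
    rewrite gcoordE [RHS]/= /transition !chartK //.
  have cx := Vc _ Vx.
  rewrite -mulmxA -trmx_mul (of_chart_trans ac ad cx dx) -mulmxA of_to_chart //.
  by rewrite mulmx1.
apply: smooth_mulmx => // j1 j2; first by rewrite ord1; exact: tr (s2 _).
under eq_fun do rewrite mxE; exact: Jtransition_smooth.
Qed.

(** Carries identities from regular points to singular ones: if g were nonzero at one point it would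
    be so on an open set, which meets D. *)
Lemma smooth_dense0 c V (D : set M) (g : 'rV[R]_n -> R) : dense D ->
  open V -> V `<=` chart_dom c -> smooth_on (c @` (chart_dom c `&` V)) g ->
  (forall y, V y -> D y -> g (c y) = 0) -> forall y, V y -> g (c y) = 0.
Proof.
move=> dD oV Vc sg g0 y Vy; have cy := Vc _ Vy.
apply/eqP; apply: contrapT => /negP gy.
have Iy : (c @` (chart_dom c `&` V)) (c y) by exists y.
have [V' [oV' V'y V'c V'g]] :=
  chart_nbhs cy (near_neq0 (smooth_continuous sg Iy) gy).
have [|y' [[Vy' V'y'] Dy']] := dD (V `&` V') _ (openI oV oV'); first by exists y.
by have := V'g _ V'y'; rewrite g0 // eqxx.
Qed.

End ChartCoordinates.

Lemma continuous_sum (T : topologicalType) (R : realType) I (r : seq I)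
    (F : I -> T -> R) (x : T) : (forall i, {for x, continuous (F i)}) ->
  {for x, continuous (fun y => \sum_(i <- r) F i y)}.
Proof.
move=> cF; elim: r => [|i r IH].
  have -> : (fun y => \sum_(i <- [::]) F i y) = cst 0.
    by apply/funext => y; rewrite big_nil.
  exact: cst_continuous.
have -> : (fun y => \sum_(j <- i :: r) F j y) =
    F i \+ (fun y => \sum_(j <- r) F j y).
  by apply/funext => y; rewrite big_cons.
exact: (continuousD (cF i) IH).
Qed.

(** * The closure of the graph as the annihilator of the extended spinor *)

Section Backward.
Context {R : realType} {n : nat} (M : smoothManifold R n) (Msing : set M)
  (Pi : M -> ext R n) (U : set M) (f : M -> R) (sigma : M -> ext R n).
Context (regular_dense : dense (~` Msing))
  (Pi2 : forall x, ~ Msing x -> homogeneous 2 (Pi x))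
  (oU : open U) (ssigma : smooth_multivector U sigma)
  (sigmaE : forall x, U x -> ~ Msing x ->
     sigma x = (f x : R) *: ext_exp (- Pi x))
  (sigma0 : forall x, U x -> sigma x <> 0).
Implicit Types (c d : chart R n M) (x y : M) (V : set M) (z : 'rV[R]_n)
  (u v : 'rV[R]_n * 'rV[R]_n).

Let L : set (gtangent M) := closure (graph_of Msing Pi).

(** As sigma has no zeros, f is nonzero at regular points, so sigma and exp(-Pi) have the same
    annihilator there. *)
Lemma sigma_graph x u : U x -> ~ Msing x ->
  clifford u (sigma x) = 0 <-> u.1 = sharp (Pi x) u.2.
Proof.
move=> Ux nx; have fx : f x != 0.
  by apply/eqP => fx; apply: (sigma0 Ux); rewrite sigmaE // fx scale0r.
rewrite sigmaE // linearZ /=; split=> [/eqP|H].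
  by rewrite scaler_eq0 (negbTE fx) /= => /eqP /clifford_exp; apply; exact: Pi2.
by rewrite (_ : clifford _ _ = 0) ?scaler0 //; apply/clifford_exp => //; exact: Pi2.
Qed.

Definition local_spinor c z : ext R n :=
  ext_map (to_chartL c (chart_inv c z)) (sigma (chart_inv c z)).

Lemma local_spinorE c x : chart_dom c x ->
  local_spinor c (c x) = ext_map (to_chartL c x) (sigma x).
Proof. by move=> cx; rewrite /local_spinor chartK. Qed.

Lemma local_spinor_smooth c S : atlas c ->
  smooth_on (c @` (chart_dom c `&` U)) (fun z => local_spinor c z S).
Proof. by move=> ac; exact: (smooth_multivectorE _ _).1. Qed.

(** The annihilator of sigma has a smooth frame of n rows even near singular points. Isotropy gives
    an invertible minor at x, hence near x, and [kernel_frame] gives the rows. *)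
Lemma local_frame x : U x -> exists (V : set M) (F : 'rV[R]_n -> 'M[R]_(n, n + n)),
  let c := chart_at x in
  [/\ open V, V x, V `<=` U `&` chart_dom c &
   [/\ forall i j, smooth_on (c @` (chart_dom c `&` V)) (fun z => F z i j),
       forall y, V y -> forall w : 'rV[R]_n, w *m F (c y) = 0 -> w = 0 &
       forall y u, V y -> clifford u (local_spinor c (c y)) = 0 <->
                  (join_row u <= F (c y))%MS]].
Proof.
move=> Ux; set c := chart_at x; have ac : atlas c by exact: chart_at_atlas.
have cx : chart_dom c x by exact: chart_at_dom.
pose T z := spinor_mx (local_spinor c z).
have sT i j : smooth_on (c @` (chart_dom c `&` U)) (fun z => T z i j).
  under eq_fun do rewrite mxE.
  apply: smooth_clifford => [|k|k|S]; try exact: smooth_cst.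
    exact: chart_open_image.
  exact: local_spinor_smooth.
have rT : (n <= \rank (T (c x)))%N.
  apply: spinor_mx_rank; rewrite local_spinorE // to_chart_at ext_map_id.
  exact: sigma0.
have [Q [B [uQ uB]]] := minor_of_rank rT.
pose A z := minor_mx (T z) Q B.
have Ix : (c @` (chart_dom c `&` U)) (c x) by exists x.
have oI := chart_open_image c oU.
have sA i j : smooth_on (c @` (chart_dom c `&` U)) (fun z => A z i j).
  apply: smooth_mulmx => // [j1 j2|j1 j2]; last exact: smooth_cst.
  apply: smooth_mulmx => // k1 k2; exact: smooth_cst.
have dA : \det (A (c x)) != 0 by move: uB; rewrite unitmxE unitfE.
have [V [oV Vx Vc VA]] :=
  chart_nbhs cx (near_neq0 (smooth_continuous (smooth_det oI sA) Ix) dA).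
exists (V `&` U), (fun z => kernel_frame (T z) Q B).
have sI : c @` (chart_dom c `&` (V `&` U)) `<=` c @` (chart_dom c `&` U).
  by apply: image_subset => y [? []].
have oVU : open (V `&` U) by exact: openI.
have oI' := chart_open_image c oVU.
have sF i j : smooth_on (c @` (chart_dom c `&` (V `&` U)))
    (fun z => kernel_frame (T z) Q B i j).
  have {}sT i' j' := smooth_sub sI (sT i' j').
  have {}sA i' j' := smooth_sub sI (sA i' j').
  apply: (@smooth_eq _ _ _ (fun z => \det (A z) * dsubmx Q i j +
    - (dsubmx Q *m T z *m B *m \adj (A z) *m usubmx Q) i j)) => //.
    by move=> z _; rewrite /kernel_frame [RHS]mxE [X in _ = X + _]mxE [X in _ = _ + X]mxE.
  apply: smoothD => //.
    by apply: smoothM => //; [exact: smooth_det|exact: smooth_cst].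
  apply: smoothN => //.
  apply: smooth_mulmx => // j1 j2; last exact: smooth_cst.
  apply: smooth_mulmx => // k1 k2; last exact: smooth_adj.
  apply: smooth_mulmx => // l1 l2; last exact: smooth_cst.
  by apply: smooth_mulmx => // m1 m2; exact: smooth_cst.
(* The frame is built to kill only [T *m B]. At regular points the graph supplies n independent
   elements of the kernel of T, which forces the two kernels to agree; density then gives [F0]
   everywhere. *)
have F0 y : (V `&` U) y -> kernel_frame (T (c y)) Q B *m T (c y) = 0.
  move=> VUy; apply/matrixP => i j; rewrite [RHS]mxE.
  apply: (smooth_dense0 (c := c) (V := V `&` U) (D := ~` Msing)
    (g := fun z => (kernel_frame (T z) Q B *m T z) i j)) => //.
  - by move=> y' [/Vc].
  - by apply: smooth_mulmx => // i' j'; exact: smooth_sub sI _.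
  move=> y' [Vy' Uy'] ny'; have cy' := Vc _ Vy'.
  pose P := ext_map (to_chartL c y') (Pi y').
  (* The rows are the points of the graph over the basis covectors; the identity block makes them
     independent. *)
  pose G : 'M[R]_(n, n + n) := row_mx (bivector_mx P) 1%:M.
  have fG : row_free G.
    rewrite -row_leq_rank -[X in (X <= _)%N](mxrank1 R n).
    rewrite (_ : 1%:M = G *m col_mx 0 1%:M) ?mxrankM_maxl //.
    by rewrite mul_row_col mulmx0 add0r mulmx1.
  have GT : G *m T (c y') = 0.
    apply/row_matrixP => k; rewrite row_mul row0; apply/mul_spinor_mx.
    rewrite local_spinorE // -[split_row _](gcoord_invK _ ac cy').
    apply/clifford_gcoord_eq0 => //; apply/sigma_graph => //.
    apply/(sharp_gcoord _ ac cy' (Pi2 ny')); rewrite gcoord_invK // sharpE.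
    rewrite row_row_mx /split_row row_mxKl row_mxKr /= !rowE mulmx1.
    by [].
  by rewrite (kernel_frame_full uQ (VA _ Vy') fG GT) mxE.
split=> //; first by move=> y [/Vc].
split=> // [y [Vy Uy] w|y u [Vy Uy]].
  exact: (kernel_frame_free uQ (VA y Vy)).
have := mul_spinor_mx (join_row u) (local_spinor c (c y)); rewrite join_rowK => <-.
split=> [uT|/submxP[w ->]]; last by rewrite -mulmxA (F0 y (conj Vy Uy)) mulmx0.
by apply: (kernel_frame_span uQ (VA y Vy)); rewrite /T uT mul0mx.
Qed.


(** The annihilator of sigma is closed in the total space over U, so the closure of the graph cannot
    leave it. *)
Lemma not_annihilated_open :
  open [set p : gtangent M | U p.1 /\ clifford p.2 (sigma p.1) <> 0].
Proof.
change (gtangent_open [set p : gtangent M | U p.1 /\ clifford p.2 (sigma p.1) <> 0]).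
move=> [x u] /= [Ux ux] c ac cx.
have {ux} : clifford (gcoord c x u) (local_spinor c (c x)) <> 0.
  by rewrite local_spinorE // => /(clifford_gcoord_eq0 _ _ ac cx).
move=> ux; have [S uS] : exists S, clifford (gcoord c x u) (local_spinor c (c x)) S != 0.
  apply: contrapT => /forallNP H; apply: ux; apply/ffunP => S; rewrite ext0.
  by apply/eqP; apply: contrapT => /negP; exact: H.
have oI := chart_open_image c oU.
have Ix : (c @` (chart_dom c `&` U)) (c x) by exists x.
(* One coefficient of the action, as a function of base point and fibre coordinates together: the
   topology of the total space requires joint continuity. *)
pose h (w : 'rV[R]_n * ('rV[R]_n * 'rV[R]_n)) := clifford w.2 (local_spinor c w.1) S.
pose w0 : 'rV[R]_n * ('rV[R]_n * 'rV[R]_n) := (c x, gcoord c x u).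
have ch : {for w0, continuous h}.
  have -> : h = fun w => \sum_i (ext_sign i S *
      (if i \in S then w.2.1 0 i else w.2.2 0 i)) * local_spinor c w.1 (toggle i S).
    by apply/funext => w; rewrite /h cliffordE.
  apply: continuous_sum => i; apply: continuousM.
    apply: continuousM; first exact: cst_continuous.
    case: (i \in S).
      apply: (continuous_comp (f := fun w => w.2.1) (g := fun r : 'rV[R]_n => r 0 i)).
        apply: (continuous_comp (f := snd) (g := fst)); [exact: cvg_snd|exact: cvg_fst].
      exact: coord_continuous.
    apply: (continuous_comp (f := fun w => w.2.2) (g := fun r : 'rV[R]_n => r 0 i)).
      apply: (continuous_comp (f := snd) (g := snd)); exact: cvg_snd.
    exact: coord_continuous.
  apply: (continuous_comp (f := fst) (g := fun z => local_spinor c z (toggle i S))).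
    exact: cvg_fst.
  exact: smooth_continuous (local_spinor_smooth _ ac) Ix.
exists [set w | (c @` (chart_dom c `&` U)) w.1 /\ h w != 0].
  apply: filterI; last exact: near_neq0 ch uS.
  have : {for w0, continuous (@fst 'rV[R]_n ('rV[R]_n * 'rV[R]_n)%type)} by exact: cvg_fst.
  by apply; exact: open_nbhs_nbhs.
move=> [y v] /= cy [[y' [cy' Uy']]].
rewrite /gtangent_chart /= => /(congr1 (chart_inv c)); rewrite !chartK // => <- hv.
split=> // vy; move: hv; rewrite /h /= local_spinorE //.
by rewrite (clifford_gcoord_eq0 _ _ ac cy').2 // ext0 eqxx.
Qed.

(** Closedness of the annihilator gives one inclusion. For the other, an annihilating u is extended
    to a continuous local section of the annihilator, which lies in the graph over the regular
    points near x. *)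
Lemma closure_graphP x u : U x -> L (x, u) <-> clifford u (sigma x) = 0.
Proof.
move=> Ux; split=> [Lu|ux].
  apply: contrapT => nux.
  have [|[y v] /= [[ny gy] [Uy]]] := Lu [set p | U p.1 /\ clifford p.2 (sigma p.1) <> 0].
    by apply: open_nbhs_nbhs; split=> //; exact: not_annihilated_open.
  by apply; apply/sigma_graph.
move=> B; rewrite nbhsE => -[B' [oB' B'u] B'B].
set c := chart_at x; have ac : atlas c by exact: chart_at_atlas.
have cx : chart_dom c x by exact: chart_at_dom.
have [V [F [oV Vx VU [sF _ FP]]]] := local_frame Ux.
have Vc : V `<=` chart_dom c by move=> y /VU [].
(* The coefficients w of u in the frame at x are kept fixed as the base point moves; this is the
   extension of u. *)
have [w wE] : exists w, join_row u = w *m F (c x).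
  apply/submxP/FP => //; rewrite local_spinorE // to_chart_at ext_map_id.
  exact: ux.
pose s z := split_row (w *m F z).
have sx : s (c x) = u by rewrite /s -wE join_rowK.
have {}oB' : gtangent_open B' by exact: oB'.
have [N nN NB'] := oB' _ B'u c ac cx.
have Ix : (c @` (chart_dom c `&` V)) (c x) by exists x.
have oI := chart_open_image c oV.
have swF j : smooth_on (c @` (chart_dom c `&` V)) (fun z => (w *m F z) 0 j).
  by apply: smooth_mulmx => // i1 i2; exact: smooth_cst.
have cs1 : {for c x, continuous (fun z => (s z).1)}.
  apply: differentiable_continuous; apply: (smooth_rV_differentiable _ Ix) => j.
  by rewrite /s /=; under eq_fun do rewrite mxE; exact: swF.
have cs2 : {for c x, continuous (fun z => (s z).2)}.
  apply: differentiable_continuous; apply: (smooth_rV_differentiable _ Ix) => j.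
  by rewrite /s /=; under eq_fun do rewrite mxE; exact: swF.
have cs : (z, ((s z).1, (s z).2)) @[z --> c x] --> (c x, ((s (c x)).1, (s (c x)).2)).
  exact: (cvg_pair (@cvg_id _ (nbhs (c x))) (cvg_pair cs1 cs2)).
have /(chart_nbhs cx)[V' [oV' V'x V'c V'N]] : nbhs (c x) [set z | N (z, s z)].
  apply: (cs N); move: nN; rewrite sx /gtangent_chart /= gcoord_at.
  by case: (u).

have [|y [[Vy V'y] ny]] := regular_dense _ (openI oV oV'); first by exists x.
have [Uy cy] := VU _ Vy.
have sy : clifford (gcoord_inv c y (s (c y))) (sigma y) = 0.
  apply/(clifford_gcoord_eq0 _ _ ac cy).
  by rewrite gcoord_invK // -local_spinorE //; apply/FP => //; rewrite split_rowK submxMl.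
exists (y, gcoord_inv c y (s (c y))); split; first by split=> //; exact/(sigma_graph _ Uy ny).
apply: B'B; apply: NB' => //; rewrite /gtangent_chart /= gcoord_invK //; exact: V'N.
Qed.

Lemma closure_graph_subbundle : smooth_subbundle U L.
Proof.
move=> x Ux; set c := chart_at x; have ac : atlas c by exact: chart_at_atlas.
have [V [F [oV Vx VU [sF freeF FP]]]] := local_frame Ux.
have Vc : V `<=` chart_dom c by move=> y /VU [].
pose s (i : 'I_n) y := gcoord_inv c y (split_row (row i (F (c y)))).
have sE y (w : 'rV[R]_n) : V y -> gcoord c y (\sum_i w 0 i *: s i y) =
    split_row (w *m F (c y)).
  move=> Vy; rewrite raddf_sum /= mulmx_sum_row raddf_sum /=.
  apply: eq_bigr => i _; rewrite [LHS]linearZ [RHS]linearZ /=; congr (_ *: _).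
  by rewrite (gcoord_invK _ ac (Vc _ Vy)).
exists V, n, s; split=> // [y /VU []//|i|y Vy].
  apply: (smooth_gsection_chart (c := c) (s := fun z => split_row (row i (F z)))) => // j /=;
    by under eq_fun do rewrite mxE mxE; exact: sF.
split.
  apply: free_family => w /(congr1 (gcoord c y)); rewrite sE // raddf0.
  move/(congr1 join_row); rewrite split_rowK raddf0; exact: freeF.
move=> u; have [Uy cy] := VU _ Vy.
rewrite span_family; apply: iff_trans (closure_graphP _ Uy) _.
apply: iff_trans (iff_sym (clifford_gcoord_eq0 _ _ ac cy)) _.
rewrite -local_spinorE //; apply: iff_trans (FP _ _ Vy) _.
split=> [/submxP[w wE]|[w ->]]; last by rewrite sE // split_rowK submxMl.
exists w; rewrite -[LHS](gcoordK _ ac cy) -[RHS](gcoordK _ ac cy) sE //.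
by rewrite -wE join_rowK.
Qed.

(** Adding to the n independent frame rows a vector u of an isotropic W that contains them keeps the
    rows isotropic, so the rank stays at most n and u already lies in their span. *)
Lemma closure_graph_maximal x : U x -> maximally_isotropic [set u | L (x, u)].
Proof.
move=> Ux; split=> [u v /(closure_graphP _ Ux) ux /(closure_graphP _ Ux) vx|].
  exact: spinor_isotropic (sigma0 Ux) ux vx.
move=> W isoW LW u uW; apply/(closure_graphP _ Ux).
have [V [F [oV Vx VU [sF freeF FP]]]] := local_frame Ux.
set c := chart_at x in V F oV Vx VU sF freeF FP *.
have Fx v : clifford v (sigma x) = 0 <-> (join_row v <= F (c x))%MS.
  by rewrite -FP // local_spinorE ?to_chart_at ?ext_map_id //; exact: chart_at_dom.
have rF : \rank (F (c x)) = n.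
  apply/eqP; rewrite -[_ == _]/(row_free (F (c x))) -kermx_eq0; apply/eqP.
  apply/row_matrixP => i; rewrite row0; apply: (freeF _ Vx).
  by rewrite -row_mul mulmx_ker row0.
have rK : (\rank (col_mx (F (c x)) (join_row u)) <= n)%N.
  have FW i : split_row (row i (F (c x))) \in W.
    by apply: LW; apply/(closure_graphP _ Ux)/Fx; rewrite split_rowK row_sub.
  have KW i : split_row (row i (col_mx (F (c x)) (join_row u))) \in W.
    case: (split_ordP i) => j ->; first by rewrite rowKu.
    by rewrite rowKd row_id join_rowK.
  by apply: isotropic_rank => i j; exact: isoW.
have FK : (F (c x) <= col_mx (F (c x)) (join_row u))%MS.
  by have := submx_refl (col_mx (F (c x)) (join_row u)); rewrite col_mx_sub => /andP[].
apply/Fx; have : (col_mx (F (c x)) (join_row u) <= F (c x))%MS.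
  by rewrite -(mxrank_leqif_sup FK) eqn_leq mxrankS //= rF.
by rewrite col_mx_sub => /andP[].
Qed.

End Backward.

(** * Involutivity *)

Section Jacobi.
Context {R : realType} {n : nat} (M : smoothManifold R n) (Msing : set M)
  (Pi : M -> ext R n).
Context (Msing_closed : closed Msing)
  (Pi_poisson : poisson_bivector (~` Msing) Pi).
Implicit Types (c d : chart R n M) (x y : M) (V : set M) (z : 'rV[R]_n).

Definition gradient (G : 'rV[R]_n -> R) z : 'rV[R]_n :=
  \row_m 'D_(delta_mx 0 m) G z.

Definition local_bivector c z : 'M[R]_n :=
  bivector_mx (ext_map (to_chartL c (chart_inv c z)) (Pi (chart_inv c z))).

Lemma regular_open c : open (chart_dom c `&` ~` Msing).
Proof. by apply: openI; [exact: chart_dom_open|exact: closed_openC]. Qed.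

Lemma local_bivector_smooth c i j : atlas c ->
  smooth_on (c @` (chart_dom c `&` ~` Msing)) (fun z => local_bivector c z i j).
Proof.
move=> ac; have oI : open (c @` (chart_dom c `&` ~` Msing)).
  by apply: chart_open_image; exact: closed_openC.
under eq_fun do rewrite mxE.
case: (i == j); first exact: smooth_cst.
apply: smoothM => //; first exact: smooth_cst.
have [[_ sPi] _] := Pi_poisson.
exact: (smooth_multivectorE _ _).1 sPi c ac _.
Qed.

Lemma differential_chart c V x (g : M -> R) (G : 'rV[R]_n -> R) : atlas c ->
  open V -> V `<=` chart_dom c -> V x -> (forall y, V y -> g y = G (c y)) ->
  differentiable G (c x) ->
  differential g x = gradient G (c x) *m (to_chartL c x)^T.
Proof.
move=> ac oV Vc Vx gG dG; set d := chart_at x; have ad : atlas d by exact: chart_at_atlas.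
have dx : chart_dom d x by exact: chart_at_dom.
have cx := Vc _ Vx.
have dtr := transition_differentiable ad ac dx cx.
have tx : transition d c (d x) = c x by rewrite /transition chartK.
have dG' : differentiable G (transition d c (d x)) by rewrite tx.
apply/rowP => l; rewrite mxE.
transitivity ('D_(delta_mx 0 l) (G \o transition d c) (d x)).
  apply: near_eq_derive; have oI := chart_open_image d oV.
  apply: filterS (open_nbhs_nbhs (conj oI _)); last by exists x.
  by move=> _ [y [dy Vy] <-]; rewrite /= chartK // gG // /transition chartK.
apply: etrans (derive_comp _ dtr dG') _.
apply: etrans (derive_sum_delta _ dG') _.
rewrite mxE; apply: eq_bigr => m _; rewrite tx !mxE to_chartJ Jtransition.unlock.
by rewrite (jacobianE _ _ dtr) (derive_coord _ _ dtr) mulrC.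
Qed.

Lemma poisson_bracket_chart c V x (f g : M -> R) (F G : 'rV[R]_n -> R) :
  atlas c -> open V -> V `<=` chart_dom c -> V x -> ~ Msing x ->
  (forall y, V y -> f y = F (c y)) -> (forall y, V y -> g y = G (c y)) ->
  differentiable F (c x) -> differentiable G (c x) ->
  poisson_bracket Pi f g x =
  pairing (gradient F (c x) *m local_bivector c (c x)) (gradient G (c x)).
Proof.
move=> ac oV Vc Vx nx fF gG dF dG; have [[hPi _] _] := Pi_poisson.
rewrite /poisson_bracket (differential_chart ac oV Vc Vx fF dF).
rewrite (differential_chart ac oV Vc Vx gG dG) sharpE -pairing_mulmx.
rewrite /local_bivector chartK; last exact: Vc.
by rewrite bivector_mx_map ?mulmxA //; exact: hPi.
Qed.

Lemma gradient_coord i z : gradient (fun z => z 0 i) z = delta_mx 0 i.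
Proof.
apply/rowP => m; rewrite !mxE (@derive_coord _ _ id) // derive_id mxE eqxx /=.
by rewrite eq_sym.
Qed.

(** The Jacobi identity for the coordinate functions of c: their brackets are the entries of
    [local_bivector], and a further bracket with a coordinate differentiates these entries. *)
Lemma jacobi_chart c x i j k : atlas c -> chart_dom c x -> ~ Msing x ->
  let P := local_bivector c (c x) in
  let dP m i j := 'D_(delta_mx 0 m) (fun z => local_bivector c z i j) (c x) in
  \sum_m (P i m * dP m j k + P j m * dP m k i + P k m * dP m i j) = 0.
Proof.
move=> ac cx nx P dP; have [_ jac] := Pi_poisson.
set V := chart_dom c `&` ~` Msing; have oV : open V by exact: regular_open.
have Vc : V `<=` chart_dom c by move=> y [].
have Vx : V x by [].
pose co (l : 'I_n) (y : M) := c y 0 l.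
have dco l : differentiable (fun z : 'rV[R]_n => z 0 l) (c x).
  exact: differentiable_coord.
have sco l : smooth_fun V (co l).
  by move=> d ad; exact: transition_smooth.
have dB l1 l2 y : V y -> differentiable (fun z => local_bivector c z l1 l2) (c y).
  by move=> Vy; apply: smooth_differentiable (local_bivector_smooth _ _ ac) _; exists y.
have coB l1 l2 y : V y -> poisson_bracket Pi (co l1) (co l2) y = local_bivector c (c y) l1 l2.
  move=> Vy; have dcoy l : differentiable (fun z : 'rV[R]_n => z 0 l) (c y).
    exact: differentiable_coord.
  rewrite (poisson_bracket_chart (F := fun z => z 0 l1) (G := fun z => z 0 l2) ac oV Vc) //;
    last by case: Vy.
  by rewrite !gradient_coord -rowE pairing_deltar mxE.
have coB2 l l1 l2 : poisson_bracket Pi (co l) (poisson_bracket Pi (co l1) (co l2)) x =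
    \sum_m P l m * dP m l1 l2.
  rewrite (poisson_bracket_chart (F := fun z => z 0 l)
    (G := fun z => local_bivector c z l1 l2) ac oV Vc Vx nx _ (coB l1 l2)
    (dco l) (dB l1 l2 x Vx)) //.
  by rewrite gradient_coord -rowE; apply: eq_bigr => m _; rewrite !mxE.
have := jac V (co i) (co j) (co k) oV _ (sco i) (sco j) (sco k) x Vx.
rewrite !coB2 !big_split /=; apply.
by move=> y [].
Qed.

End Jacobi.

(** * The Dorfman bracket of sections of a graph, in coordinates *)

Section Dorfman.
Context {R : realType} {n : nat}.
Implicit Types (X Y a b : 'rV[R]_n -> 'rV[R]_n) (z : 'rV[R]_n).

Definition local_dorfman X a Y b z : 'rV[R]_n * 'rV[R]_n :=
  (lie_bracket X Y z, lie_derivative X b z - contract_d Y a z).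

Lemma local_dorfmanE X a Y b z : differentiable X z -> differentiable Y z ->
  differentiable b z ->
  local_dorfman X a Y b z =
  (X z *m jacobian Y z - Y z *m jacobian X z,
   X z *m jacobian b z + b z *m (jacobian X z)^T -
     Y z *m (jacobian a z - (jacobian a z)^T)).
Proof.
move=> dX dY db; congr (_, _); rewrite /lie_bracket /lie_derivative.
  congr (_ - _); exact: deriveEjacobian.
by congr (_ + _ - _); exact: deriveEjacobian.
Qed.

(** The Jacobian at z of y |-> v P(y) with v held fixed: the term of the product rule for a P in
    which P is differentiated. *)
Definition contract_derivative (P : 'rV[R]_n -> 'M[R]_n) (v : 'rV[R]_n) z : 'M[R]_n :=
  \matrix_(i, k) \sum_l v 0 l * 'D_(delta_mx 0 i) (fun y => P y l k) z.

Lemma jacobian_mulmx (P : 'rV[R]_n -> 'M[R]_n) X a z : differentiable a z ->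
  differentiable X z ->
  (forall l k, differentiable (fun y => P y l k) z) ->
  (\forall y \near z, X y = a y *m P y) ->
  jacobian X z = jacobian a z *m P z + contract_derivative P (a z) z.
Proof.
move=> da dX dP XaP; apply/matrixP => i k.
have dac l : differentiable (fun y => a y 0 l) z.
  apply: (@differentiable_comp _ _ _ _ a (fun r : 'rV[R]_n => r 0 l)) => //.
  exact: differentiable_coord.
rewrite (jacobianE _ _ dX).
have -> : 'D_(delta_mx 0 i) (fun y => X y 0 k) z =
    'D_(delta_mx 0 i) (\sum_l ((fun y => a y 0 l) * (fun y => P y l k))) z.
  apply: near_eq_derive; near=> y; rewrite (near XaP y) //.
  by rewrite mxE fct_sumE.
rewrite derive_sum => [|l]; last first.
  by apply: derivableM; exact: diff_derivable.
rewrite mxE mxE [X in _ + X]mxE -big_split; apply: eq_bigr => l _ /=.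
rewrite deriveM; try exact: diff_derivable.
by rewrite (jacobianE _ _ da) addrC /GRing.scale /=; congr (_ + _); exact: mulrC.
Unshelve. all: by end_near. Qed.

Lemma sum_mul3 (x y : 'I_n -> 'I_n -> R) :
  \sum_m (\sum_p x p m) * (\sum_q y m q) = \sum_p \sum_q \sum_m x p m * y m q.
Proof.
under eq_bigr do rewrite big_distrlr /=.
rewrite exchange_big /=; apply: eq_bigr => p _; exact: exchange_big.
Qed.

(** The three-index Jacobi identity contracted with a and b in two of its indices. Antisymmetry of P
    and dP brings the second and third terms to cyclic order. *)
Lemma jacobi_contract (P : 'M[R]_n) (a b : 'rV[R]_n) (dP : 'I_n -> 'I_n -> 'I_n -> R)
    (N := fun v : 'rV[R]_n => \matrix_(i, k) \sum_l v 0 l * dP i l k : 'M[R]_n) :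
  (forall i j, P i j = - P j i) -> (forall m i j, dP m i j = - dP m j i) ->
  (forall i j k, \sum_m (P i m * dP m j k + P j m * dP m k i + P k m * dP m i j) = 0) ->
  a *m P *m N b - b *m P *m N a = b *m (N a)^T *m P.
Proof.
move=> Panti dPanti jac; apply/eqP; rewrite subr_eq addrC -subr_eq0; apply/eqP.
apply/rowP => j.
have e1 : (a *m P *m N b) 0 j =
    \sum_p \sum_q \sum_m (a 0 p * P p m) * (b 0 q * dP m q j).
  by rewrite -sum_mul3 mxE; apply: eq_bigr => m _; rewrite !mxE.
have e2 : (b *m P *m N a) 0 j =
    \sum_p \sum_q \sum_m (b 0 q * P q m) * (a 0 p * dP m p j).
  by rewrite exchange_big -sum_mul3 mxE; apply: eq_bigr => m _; rewrite !mxE.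
have e3 : (b *m (N a)^T *m P) 0 j =
    \sum_p \sum_q \sum_m b 0 q * (a 0 p * dP m p q) * P m j.
  rewrite mxE; under eq_bigr do rewrite mxE.
  under eq_bigr => m _.
    rewrite mulr_suml; under eq_bigr do rewrite 2!mxE mulr_sumr mulr_suml.
    over.
  rewrite exchange_big; under eq_bigr do rewrite exchange_big.
  by rewrite exchange_big.
rewrite mxE [X in _ + X]mxE [X in _ - X]mxE e1 e2 e3 [RHS]mxE.
rewrite -big_split -sumrB big1 // => p _ /=; rewrite -big_split -sumrB big1 // => q _ /=.
rewrite -big_split -sumrB /=.
transitivity (a 0 p * b 0 q *
  \sum_m (P p m * dP m q j + P q m * dP m j p + P j m * dP m p q)); last first.
  by rewrite jac mulr0.
rewrite mulr_sumr; apply: eq_bigr => m _; rewrite (Panti j m) (dPanti m j p); ring.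
Qed.

End Dorfman.

Section DorfmanGraph.
Context {R : realType} {n : nat}.
Implicit Types (X Y a b : 'rV[R]_n -> 'rV[R]_n) (z : 'rV[R]_n)
  (P : 'rV[R]_n -> 'M[R]_n) (W : set 'rV[R]_n).

(** After X = a P and Y = b P are substituted, all terms with derivatives of a or b cancel by
    antisymmetry of P. What remains contains derivatives of P only and is [jacobi_contract]. *)
Lemma local_dorfman_graph P X a Y b z :
  differentiable X z -> differentiable a z -> differentiable Y z ->
  differentiable b z -> (forall l k, differentiable (fun y => P y l k) z) ->
  (forall y i j, P y i j = - P y j i) ->
  (forall i j k, let dP m i j := 'D_(delta_mx 0 m) (fun y => P y i j) z in
     \sum_m (P z i m * dP m j k + P z j m * dP m k i + P z k m * dP m i j) = 0) ->
  (\forall y \near z, X y = a y *m P y) -> (\forall y \near z, Y y = b y *m P y) ->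
  (local_dorfman X a Y b z).1 = (local_dorfman X a Y b z).2 *m P z.
Proof.
move=> dX da dY db dP Panti jac XaP YbP; rewrite local_dorfmanE //=.
rewrite (jacobian_mulmx da dX dP XaP) (jacobian_mulmx db dY dP YbP).
rewrite (nbhs_singleton XaP) (nbhs_singleton YbP).
have dPanti m i j : 'D_(delta_mx 0 m) (fun y => P y i j) z =
    - 'D_(delta_mx 0 m) (fun y => P y j i) z.
  rewrite -deriveN; last exact: diff_derivable.
  by congr ('D_ _ _ _); apply/funext => y; rewrite Panti.
have := jacobi_contract (a z) (b z) (Panti z) dPanti jac.
rewrite -/(contract_derivative P (a z) z) -/(contract_derivative P (b z) z).
have PT : (P z)^T = - P z.
  by apply/matrixP => i j; rewrite !mxE Panti.
set Na := contract_derivative P (a z) z; set Nb := contract_derivative P (b z) z.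
move: (a z) (b z) (jacobian a z) (jacobian b z) => a0 b0 JA JB E.
rewrite [(JA *m _ + _)^T]raddfD /= trmx_mul PT.
rewrite !(mulmxDr, mulmxDl, mulmxN, mulNmx) !mulmxA.
have -> : b0 *m Na^T *m P z = a0 *m P z *m Nb - b0 *m P z *m Na by [].
set x1 := a0 *m P z *m JB *m P z; set x2 := b0 *m P z *m JA *m P z.
set x3 := b0 *m P z *m JA^T *m P z; set y1 := _ *m Nb; set y2 := _ *m Na.
apply/rowP => j; rewrite !mxE; ring.
Qed.

Lemma jacobian_smooth W X i j : open W ->
  (forall j, smooth_on W (fun z => X z 0 j)) ->
  smooth_on W (fun z => jacobian X z i j).
Proof.
move=> oW sX; apply: smooth_eq (smooth_derive (delta_mx 0 i) (sX j)) => // z Wz.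
by rewrite jacobianE //; exact: smooth_rV_differentiable sX Wz.
Qed.

(** Supplies the continuity needed to extend involutivity from regular to singular points. *)
Lemma local_dorfman_smooth W X a Y b j : open W ->
  (forall j, smooth_on W (fun z => X z 0 j)) ->
  (forall j, smooth_on W (fun z => a z 0 j)) ->
  (forall j, smooth_on W (fun z => Y z 0 j)) ->
  (forall j, smooth_on W (fun z => b z 0 j)) ->
  smooth_on W (fun z => (local_dorfman X a Y b z).1 0 j) /\
  smooth_on W (fun z => (local_dorfman X a Y b z).2 0 j).
Proof.
move=> oW sX sa sY sb.
have row_smooth (Z : 'rV[R]_n -> 'rV[R]_n) : (forall j, smooth_on W (fun z => Z z 0 j)) ->
    forall i j, smooth_on W (fun z => Z z i j).
  by move=> sZ i k; rewrite ord1; exact: sZ.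
have mul (Z : 'rV[R]_n -> 'rV[R]_n) (A : 'rV[R]_n -> 'M[R]_n) :
    (forall j, smooth_on W (fun z => Z z 0 j)) ->
    (forall i j, smooth_on W (fun z => A z i j)) ->
    smooth_on W (fun z => (Z z *m A z) 0 j).
  by move=> sZ sA; apply: smooth_mulmx => //; exact: row_smooth.
have J (Z : 'rV[R]_n -> 'rV[R]_n) i k : (forall j, smooth_on W (fun z => Z z 0 j)) ->
    smooth_on W (fun z => jacobian Z z i k) by exact: jacobian_smooth.
have E z : W z -> local_dorfman X a Y b z = (X z *m jacobian Y z - Y z *m jacobian X z,
   X z *m jacobian b z + b z *m (jacobian X z)^T -
     Y z *m (jacobian a z - (jacobian a z)^T)).
  move=> Wz; apply: local_dorfmanE.
  - exact: smooth_rV_differentiable sX Wz.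
  - exact: smooth_rV_differentiable sY Wz.
  - exact: smooth_rV_differentiable sb Wz.
split.
  apply: (@smooth_eq _ _ _ (fun z => (X z *m jacobian Y z) 0 j +
    - (Y z *m jacobian X z) 0 j)) => // [z Wz|].
    by rewrite E // [RHS]mxE [X in _ = _ + X]mxE.
  by apply: smoothD => //; [|apply: smoothN => //]; apply: mul => // i k; exact: J.
apply: (@smooth_eq _ _ _ (fun z => (X z *m jacobian b z) 0 j +
  (b z *m (jacobian X z)^T) 0 j +
  - (Y z *m (jacobian a z - (jacobian a z)^T)) 0 j)) => // [z Wz|].
  by rewrite E // [RHS]mxE [X in _ = X + _]mxE [X in _ = _ + X]mxE.
apply: smoothD => //; first apply: smoothD => //; last apply: smoothN => //;
  apply: mul => // i k.
- exact: J.
- by under eq_fun do rewrite mxE; exact: J.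
- apply: (@smooth_eq _ _ _ (fun z => jacobian a z i k + - jacobian a z k i)) => //.
    by move=> z _; rewrite [RHS]mxE [X in _ = _ + X]mxE [X in _ = _ - X]mxE.
  by apply: smoothD => //; [|apply: smoothN => //]; exact: J.
Qed.

End DorfmanGraph.

(** * Involutivity of the closure and the equivalence *)

Section Main.
Context {R : realType} {n : nat} (M : smoothManifold R n) (Msing : set M)
  (Pi : M -> ext R n).

Theorem extends_removable (m : M) : closed Msing -> dense (~` Msing) ->
  poisson_bivector (~` Msing) Pi ->
  (exists (U : set M) (f : M -> R),
    [/\ open U, U m, smooth_fun U f &
      exists sigma : M -> ext R n,
        [/\ smooth_multivector U sigma,
            forall x, U x -> ~ Msing x ->
              sigma x = (f x : R) *: ext_exp (- Pi x) &
            forall x, U x -> sigma x <> 0]]) ->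
  removable Msing Pi m.
Proof.
move=> cM dM PiP [U [f [oU Um _ [sigma [ssigma sigmaE sigma0]]]]].
have Pi2 x : ~ Msing x -> homogeneous 2 (Pi x) by have [[H _] _] := PiP; exact: H.
have CP := closure_graphP dM Pi2 oU ssigma sigmaE sigma0.
exists U; split=> //; split.
- exact: (closure_graph_subbundle dM Pi2 oU ssigma sigmaE sigma0).
- exact: (closure_graph_maximal dM Pi2 oU ssigma sigmaE sigma0).
move=> V s t oV VU ss st Ls Lt y Vy; apply/(CP _ _ (VU _ Vy)).
set c := chart_at y; have ac : atlas c by exact: chart_at_atlas.
have cy : chart_dom c y by exact: chart_at_dom.
set V1 := V `&` chart_dom c.
have oV1 : open V1 by apply: openI => //; exact: chart_dom_open.
pose loc (u : M -> 'rV[R]_n * 'rV[R]_n) z := gcoord c (chart_inv c z) (u (chart_inv c z)).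
pose D := local_dorfman (fun z => (loc s z).1) (fun z => (loc s z).2)
                        (fun z => (loc t z).1) (fun z => (loc t z).2).
have sV1 : c @` (chart_dom c `&` V1) `<=` c @` (chart_dom c `&` V).
  by apply: image_subset => x [? []].
have oI := chart_open_image c oV1.
have ls1 j : smooth_on (c @` (chart_dom c `&` V1)) (fun z => (loc s z).1 0 j).
  exact: smooth_sub sV1 (ss c ac j).1.
have ls2 j : smooth_on (c @` (chart_dom c `&` V1)) (fun z => (loc s z).2 0 j).
  exact: smooth_sub sV1 (ss c ac j).2.
have lt1 j : smooth_on (c @` (chart_dom c `&` V1)) (fun z => (loc t z).1 0 j).
  exact: smooth_sub sV1 (st c ac j).1.
have lt2 j : smooth_on (c @` (chart_dom c `&` V1)) (fun z => (loc t z).2 0 j).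
  exact: smooth_sub sV1 (st c ac j).2.
(* [dorfman] at x uses [chart_at x], so its values cannot be compared along nearby points. The
   bracket is instead computed at all x of V1 in the single chart c of y, where it is smooth and
   [smooth_dense0] applies; at y itself the two agree. *)
suff H x : V1 x -> clifford (D (c x)) (local_spinor sigma c (c x)) = 0.
  have := H y (conj Vy cy); rewrite local_spinorE // to_chart_at ext_map_id.
  exact.
move=> V1x; apply/ffunP => S; rewrite ext0.
apply: (smooth_dense0 (c := c) (V := V1) (D := ~` Msing)
  (g := fun z => clifford (D z) (local_spinor sigma c z) S)) => //.
- by move=> x' [].
- apply: smooth_clifford => // [j|j|T].
  + exact: (local_dorfman_smooth j oI ls1 ls2 lt1 lt2).1.
  + exact: (local_dorfman_smooth j oI ls1 ls2 lt1 lt2).2.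
  + have sI : c @` (chart_dom c `&` V1) `<=` c @` (chart_dom c `&` U).
      by apply: image_subset => x' [? [/VU]].
    exact: smooth_sub sI (local_spinor_smooth ssigma T ac).
move=> {V1x}{}x [Vx cx] nx; have Ux := VU _ Vx.
rewrite (_ : clifford _ _ = 0) ?ext0 // local_spinorE //.
rewrite -[D _](gcoord_invK _ ac cx); apply/clifford_gcoord_eq0 => //.
apply/(sigma_graph Pi2 sigmaE sigma0 _ Ux nx).
apply/(sharp_gcoord _ ac cx (Pi2 x nx)); rewrite gcoord_invK // sharpE.
have <- : local_bivector Pi c (c x) = bivector_mx (ext_map (to_chartL c x) (Pi x)).
  by rewrite /local_bivector chartK.
have Ix : (c @` (chart_dom c `&` V1)) (c x) by exists x.
have In : (c @` (chart_dom c `&` ~` Msing)) (c x) by exists x.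
(* Since the regular set is open, a section of the closure lies on the graph in a whole
   neighbourhood of x, so the relation can be differentiated there. *)
have graph u : (forall y', V y' -> closure (graph_of Msing Pi) (y', u y')) ->
    \forall z \near c x, (loc u z).1 = (loc u z).2 *m local_bivector Pi c z.
  move=> Lu; have oN : open (V1 `&` ~` Msing) by apply: openI => //; exact: closed_openC.
  have oIN := chart_open_image c oN.
  apply: filterS (open_nbhs_nbhs (conj oIN _)); last by exists x.
  move=> _ [x' [cx' [[Vx' _] nx']] <-]; rewrite /loc /local_bivector chartK // -sharpE.
  apply/(sharp_gcoord _ ac cx' (Pi2 _ nx')).
  apply/(sigma_graph Pi2 sigmaE sigma0 _ (VU _ Vx') nx').
  by apply/(CP _ _ (VU _ Vx')); exact: Lu.
apply: local_dorfman_graph.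
- exact: smooth_rV_differentiable ls1 Ix.
- exact: smooth_rV_differentiable ls2 Ix.
- exact: smooth_rV_differentiable lt1 Ix.
- exact: smooth_rV_differentiable lt2 Ix.
- by move=> l k; exact: smooth_differentiable (local_bivector_smooth cM PiP l k ac) In.
- by move=> z i j; exact: bivector_mx_antisym.
- by move=> i j k; exact: (jacobi_chart cM PiP i j k ac cx nx).
- exact: graph.
- exact: graph.
Qed.

End Main.

Theorem proposition5p3 (R : realType) (n : nat) (M : smoothManifold R n)
    (Msing : set M) (Pi : M -> ext R n) (m : M)
    (n_ge2 : (2 <= n)%N)
    (Msing_closed : closed Msing)
    (Msing_codense : dense (~` Msing))
    (Pi_poisson : poisson_bivector (~` Msing) Pi)
    (m_sing : Msing m)
    (Pi_sing : has_singularity Msing Pi m) :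
  removable Msing Pi m <->
  exists (U : set M) (f : M -> R),
    [/\ open U, U m, smooth_fun U f &
      exists sigma : M -> ext R n,
        [/\ smooth_multivector U sigma,
            forall x, U x -> ~ Msing x ->
              sigma x = (f x : R) *: ext_exp (- Pi x) &
            forall x, U x -> sigma x <> 0]].
Proof.
have [[hPi _] _] := Pi_poisson; split; first exact: removable_extends.
exact: extends_removable.
Qed.
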